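(* There exists a universal constant $c>0$ such that the following holds. Let $(X_t,Y_t)_t$, with $X_t\in\mathbb{R}^p$, $Y_t\in\mathbb{R}^q$, be a strictly stationary, mean-zero, $\alpha$-mixing Gaussian process, and let $$\eta=\frac{\lambda_{\min}(\Sigma_X)}{108\pi\,S_\alpha(T)\,\lambda_{\max}(\Sigma_X)}.$$ If $T\ge\frac{42e\log(p)}{c\min\{1,\eta^2\}}$, then with probability at least $1-2\exp\left(-\frac c2T\min\{1,\eta^2\}\right)$, for every vector $v\in\mathbb{R}^p$, $$|v'\hat\Gamma v|\ \ge\ \alpha_{\mathrm{RE}}\|v\|_2^2-\tau(T,p)\|v\|_1^2,$$ where $$\alpha_{\mathrm{RE}}=\tfrac12\lambda_{\min}(\Sigma_X),\qquad\tau(T,p)=\alpha_{\mathrm{RE}}\Big/\left\lceil c\,\frac{T}{4\log(p)}\min\{1,\eta^2\}\right\rceil .$$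
   Context: $\mathbf{X}=(X_1,\dots,X_T)'\in\mathbb{R}^{T\times p}$, $\hat\Gamma=\mathbf{X}'\mathbf{X}/T$; prime denotes transpose. $\Sigma_X=\mathbb{E}[X_tX_t']$ is positive definite and $p\ge2$, so that the displayed quantities are well defined. $\lambda_{\min},\lambda_{\max}$ are extreme eigenvalues. $\alpha$-mixing: for random elements $U,V$, $\alpha(U,V)=\sup\{|P(A\cap B)-P(A)P(B)|: A\in\sigma(U),B\in\sigma(V)\}$. For a stationary process $(Z_t)$ (extended to index set $\mathbb{Z}$), $\alpha(l)=\alpha(Z_{-\infty:t},Z_{t+l:\infty})$, where the same formula is used for $l=0$. The process is $\alpha$-mixing if $\alpha(l)\to0$ as $l\to\infty$. Here $Z_t=(X_t,Y_t)$, and $S_\alpha(T)=\sum_{l=0}^T\alpha(l)$. *)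

(* Defs.v *)
From HB Require Import structures.
From mathcomp Require Import all_boot all_order all_algebra.
From mathcomp Require Import all_classical all_reals all_analysis.
Set Implicit Arguments.
Unset Strict Implicit.
Unset Printing Implicit Defensive.
Import Order.TTheory GRing.Theory Num.Theory.
Import numFieldNormedType.Exports.
Local Open Scope classical_set_scope.
Local Open Scope ring_scope.

(* A vector-valued process is a family [Z t i] of real random variables, with
   [t : int] the time and [i] in a finite type the coordinate: [Z t] is a
   random vector of R^I. *)

Section Processes.
Context (R : realType) (d : measure_display) (Omega : measurableType d)
  (P : probability Omega R).

(* The process Z_t = (X_t, Y_t), with coordinates indexed by 'I_p + 'I_q. *)
Definition joint_process (p q : nat) (X : int -> 'I_p -> {RV P >-> R})
    (Y : int -> 'I_q -> {RV P >-> R}) (t : int) (i : 'I_p + 'I_q) :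
    {RV P >-> R} :=
  match i with inl j => X t j | inr j => Y t j end.

Section OneProcess.
Context (I : finType) (Z : int -> I -> {RV P >-> R}).

(* Finite-dimensional distributions are invariant under time shifts; [A]
   ranges over the Borel sets of R^n. *)
Definition strictly_stationary : Prop :=
  forall (n : nat) (t : 'I_n -> int) (i : 'I_n -> I) (h : int)
    (A : set (n.-tuple R)), measurable A ->
    P ((fun w => [tuple Z (t k + h) (i k) w | k < n]) @^-1` A) =
    P ((fun w => [tuple Z (t k) (i k) w | k < n]) @^-1` A).

Definition mean_zero : Prop := forall t i, ('E_P[Z t i] = 0)%E.

(* The normal law N(m, s^2), including the degenerate case s = 0, for which
   [normal_prob m 0] is by convention not the Dirac mass at m. *)
Definition gaussian_law (m s : R) (A : set R) : \bar R :=
  if s == 0 then \d_m A else normal_prob m s A.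

(* Every finite linear combination of the variables [Z t i] is normal. *)
Definition gaussian_process : Prop :=
  forall (n : nat) (t : 'I_n -> int) (i : 'I_n -> I) (a : 'I_n -> R),
  exists m s : R, forall A : set R, measurable A ->
    P ((fun w => \sum_(k < n) a k * Z (t k) (i k) w) @^-1` A) =
    gaussian_law m s A.

Definition alpha_coef (F G : set (set Omega)) : R :=
  sup [set x | exists A B, [/\ F A, G B &
    x = `|fine (P (A `&` B)) - fine (P A) * fine (P B)|]].

(* sigma(Z_t : t \in D) *)
Definition sigma_process (D : set int) : set (set Omega) :=
  <<s [set A | exists t i B, [/\ D t, measurable B & A = Z t i @^-1` B]] >>.

(* alpha(Z_{-oo:t}, Z_{t+l:oo}) at t = 0; by stationarity t is irrelevant. *)
Definition alpha_mix (l : nat) : R :=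
  alpha_coef (sigma_process [set t | t <= 0]) (sigma_process [set t | l%:Z <= t]).

Definition alpha_mixing : Prop := alpha_mix l @[l --> \oo] --> (0 : R).

Definition S_alpha (T : nat) : R := \sum_(0 <= l < T.+1) alpha_mix l.

End OneProcess.

Section Regressors.
Context (p : nat) (X : int -> 'I_p -> {RV P >-> R}).

(* Sigma_X = E[X_t X_t'] at t = 0; by stationarity t is irrelevant. *)
Definition Sigma_mx : 'M[R]_p :=
  \matrix_(i < p, j < p) fine ('E_P[X 0%R i \* X 0%R j])%E.

(* The rows are X_1', ..., X_T'. *)
Definition design_mx (T : nat) (w : Omega) : 'M[R]_(T, p) :=
  \matrix_(t < T, i < p) X (t.+1)%:Z i w.

Definition Gamma_hat (T : nat) (w : Omega) : 'M[R]_p :=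
  T%:R^-1 *: ((design_mx T w)^T *m design_mx T w).

End Regressors.
End Processes.

Section LinearAlgebra.
Context (R : realType) (n : nat).

Definition posdefmx (A : 'M[R]_n) : Prop :=
  A^T = A /\ forall v : 'cV[R]_n, v != 0 -> 0 < (v^T *m A *m v) 0 0.

(* Meant for symmetric [A] and 0 < n, where the spectrum is a nonempty finite
   set of reals, so that [inf] and [sup] are its least and greatest elements. *)
Definition lambda_min (A : 'M[R]_n) : R := inf [set a | eigenvalue A a].
Definition lambda_max (A : 'M[R]_n) : R := sup [set a | eigenvalue A a].

Definition l1norm (v : 'cV[R]_n) : R := \sum_(i < n) `|v i 0|.
Definition l2norm (v : 'cV[R]_n) : R := Num.sqrt (\sum_(i < n) v i 0 ^+ 2).

End LinearAlgebra.

(* Main.v *)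
Require Import Defs.
From HB Require Import structures.
From mathcomp Require Import all_boot all_order all_algebra.
From mathcomp Require Import complex.
From mathcomp Require Import all_classical all_reals all_analysis.
From mathcomp Require Import measurable_realfun ring lra zify.
Set Implicit Arguments.
Unset Strict Implicit.
Unset Printing Implicit Defensive.
Import Order.TTheory GRing.Theory Num.Theory.
Import numFieldNormedType.Exports.
Local Open Scope classical_set_scope.
Local Open Scope ring_scope.

(** Write S for Sigma_X, G for the random matrix X'X/T, lam for the least
    eigenvalue of S and q(x) = x'(G - S)x + (lam/4) |x|_2^2.

    Fixed vectors. For a fixed u the number u'Gu is the mean of U_1^2, ...,
    U_T^2, where U_t = u'X_t is a stationary centred Gaussian sequence of
    variance v = u'Su. Mixing makes its covariances summable. Indeed, for
    jointly Gaussian U, V of variance 1 and correlation r,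
      E[sin U sin V] = exp(-1) sinh r,
    and sin U, sin V are bounded, so the covariance inequality for mixing
    sigma-algebras gives |r| <= 4 e alpha ([gaussian_correlation_mixing]). Hence
    the covariance matrix Q of (U_1, ..., U_T) has trace T v, and its rows are
    absolutely summable with sum at most K = 8 e S_alpha(T) v. By the spectral
    theorem ([real_spectral]) the sum of the U_t^2 is a sum of squares of
    uncorrelated normal variables with variances in [0, K], whose Laplace
    transform is explicit, and Chernoff's bound gives deviations of size T dl
    with probability at most exp(- T dl^2 / (16 K^2)) on each side
    ([quadratic_lower_tail], [quadratic_upper_tail]). With dl = (lam/4) |u|_2^2
    the exponent is at least T eta^2 / 6, whatever u is ([Gamma_hat_tails]).

    All vectors at once. Call word a sum of s + 1 vectors of the form e_i or
    - e_i. If q >= 0 on all words, then Maurey's empirical method transfers this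
    to every v: draw s + 1 signed basis vectors independently with mean
    v / |v|_1; since q is nonnegative at their sum, taking expectations gives
      0 <= s q(v) + |v|_1^2 max_i q(e_i)
    ([maurey_bound]). Together with q(e_i) <= lam/2 for all i, and with s the
    integer in the denominator of tau, this is the desired inequality
    ([restricted_eigenvalue_extension]). Only (2p)^(s+1) words and p basis
    vectors enter, so a union bound applies, and the lower bound on T makes the
    logarithm of their number a small part of T min(1, eta^2)
    ([union_count_le]). This works with c = 1/10.

    The event in the theorem is an uncountable intersection; it is measurable
    because by continuity rational vectors v suffice
    ([measurable_restricted_eigenvalue]). *)

(** * Gaussian integrals *)

Section normal_integrals.
Import HBNNSimple.
Context {R : realType}.
Local Notation mu := (@lebesgue_measure R).
Implicit Types m s t a b : R.

(** The normal law is defined by integrating its density over sets, so the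
    formula holds for indicators, hence for simple functions, and passes to
    monotone limits. *)
Lemma ge0_integral_normal_prob m s (f : R -> R) :
  measurable_fun setT f -> (forall x, 0 <= f x) ->
  (\int[normal_prob m s]_x (f x)%:E =
   \int[mu]_x (f x * normal_pdf m s x)%:E)%E.
Proof.
move=> mf f0.
have mEf : measurable_fun [set: measurableTypeR R] (EFin \o f) by exact/measurable_EFinP.
have mpdf : measurable_fun [set: measurableTypeR R] (normal_pdf m s).
  exact: measurable_normal_pdf.
pose g := nnsfun_approx measurableT mEf.
have mg n : measurable_fun [set: measurableTypeR R] (g n) by exact: measurable_funPT.
have gcvg x : (g n x)%:E @[n --> \oo] --> (f x)%:E.
  by apply: cvg_nnsfun_approx => //= y _; rewrite lee_fin.
have gnd x : nondecreasing_seq (fun n => (g n x)%:E).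
  by move=> i j ij; rewrite lee_fin; exact/lefP/nd_nnsfun_approx.
have h1 : (\int[normal_prob m s]_x (g n x)%:E)%E @[n --> \oo] -->
    (\int[normal_prob m s]_x (f x)%:E)%E.
  under eq_integral do rewrite -(cvg_lim _ (gcvg _))//.
  apply: cvg_monotone_convergence => //.
  - by move=> n; apply/measurable_EFinP; exact: mg.
  - by move=> n x _; rewrite lee_fin.
have h2 : (\int[mu]_x (g n x * normal_pdf m s x)%:E)%E @[n --> \oo] -->
    (\int[mu]_x (f x * normal_pdf m s x)%:E)%E.
  have gcvg2 x : (g n x * normal_pdf m s x)%:E @[n --> \oo] -->
      (f x * normal_pdf m s x)%:E.
    rewrite EFinM; under eq_fun do rewrite EFinM.
    by apply: cvgeZr => //; exact: gcvg.
  under eq_integral do rewrite -(cvg_lim _ (gcvg2 _))//.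
  apply: cvg_monotone_convergence => //.
  - by move=> n; apply/measurable_EFinP/measurable_funM.
  - by move=> n x _; rewrite lee_fin mulr_ge0// normal_pdf_ge0.
  - move=> x _ i j ij; rewrite lee_fin ler_wpM2r ?normal_pdf_ge0//.
    by have := gnd x _ _ ij; rewrite lee_fin.
have h12 n : (\int[normal_prob m s]_x (g n x)%:E)%E =
    (\int[mu]_x (g n x * normal_pdf m s x)%:E)%E.
  transitivity (sintegral (normal_prob m s) (g n)).
    by rewrite integralT_nnsfun.
  rewrite sintegralE.
  transitivity (\int[mu]_x (\sum_(r \in range (g n))
      (r * \1_(g n @^-1` [set r]) x * normal_pdf m s x)%:E))%E; last first.
    apply: eq_integral => x _; rewrite fsumEFin//; congr EFin.
    rewrite [in RHS](fimfunE (g n) x) fsbig_finite// [in RHS]fsbig_finite//=.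
    by rewrite mulr_suml.
  rewrite ge0_integral_fsum//; last 2 first.
  - move=> r; apply/measurable_EFinP/measurable_funM => //.
    by apply: measurable_funM => //.
  - move=> r x _; rewrite lee_fin; apply: mulr_ge0; last exact: normal_pdf_ge0.
    exact: nnfun_muleindic_ge0.
  apply: eq_fsbigr => r rr.
  under eq_integral do rewrite -mulrA EFinM.
  have mi : measurable_fun [set: measurableTypeR R] (EFin \o (fun x : measurableTypeR R => \1_(g n @^-1` [set r]) x * normal_pdf m s x)).
    by apply/measurable_EFinP/measurable_funM => //.
  rewrite ge0_integralZl//; last first.
  - by move: rr; rewrite inE => -[x _ <-]; rewrite lee_fin.
  - by move=> x _; rewrite lee_fin mulr_ge0 ?normal_pdf_ge0.
  congr (_ * _)%E.
  rewrite [LHS]/= /normal_prob [LHS]integral_mkcond/=; apply: eq_integral => x _ /=.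
  by rewrite patchE indicE; case: ifPn => _; rewrite ?mul1r ?mul0r.
apply: (cvg_unique _ _ h2) => //.
by move: h1; under eq_fun do rewrite h12.
Qed.

Lemma measurable_expRM t : measurable_fun [set: R] (fun x : R => expR (t * x)).
Proof. by apply: measurableT_comp => //; exact: measurable_funM. Qed.

(** Completing the square: multiplied by [expR (t * x)], the density of N(m, s^2)
    becomes a constant times the density of N(m + t s^2, s^2). *)
Lemma normal_mgf m s t : s != 0 ->
  (\int[normal_prob m s]_x (expR (t * x))%:E =
   (expR (t * m + t ^+ 2 * s ^+ 2 / 2))%:E)%E.
Proof.
move=> s0; rewrite ge0_integral_normal_prob//; first last.
- exact: measurable_expRM.
rewrite (eq_integral (fun x : measurableTypeR R =>
   (expR (t * m + t ^+ 2 * s ^+ 2 / 2))%:E * (normal_pdf (m + t * s ^+ 2) s x)%:E)%E); last first.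
  move=> x _; rewrite -EFinM !normal_pdfE// !mulrA ![_ * normal_peak s]mulrC -!mulrA -!expRD.
  do 3 f_equal; field.
  by rewrite s0.
rewrite ge0_integralZl//.
- by rewrite integral_normal_pdf mule1.
- by apply/measurable_EFinP; exact: measurable_normal_pdf.
- by move=> x _; rewrite lee_fin normal_pdf_ge0.
Qed.

Lemma normal_peak_gt0E s : 0 < s ->
  normal_peak s = s^-1 * (Num.sqrt (pi *+ 2))^-1.
Proof.
move=> s0.
by rewrite /normal_peak -mulrnAr sqrtrM ?sqr_ge0// sqrtr_sqr gtr0_norm// invfM.
Qed.

(** Multiplied by [expR (a * x ^+ 2)], the standard normal density becomes a
    constant times the centred normal density of variance (1 - 2a)^-1. *)
Lemma normal_square_mgf a : a < 2^-1 ->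
  (\int[normal_prob 0 1]_x (expR (a * x ^+ 2))%:E =
   (Num.sqrt (1 - 2 * a))^-1%:E)%E.
Proof.
move=> a12.
have a0 : 0 < 1 - 2 * a by lra.
set v := Num.sqrt (1 - 2 * a).
have v0 : 0 < v by rewrite sqrtr_gt0.
have v2 : v ^+ 2 = 1 - 2 * a by rewrite sqr_sqrtr// ltW.
rewrite ge0_integral_normal_prob//; first last.
- apply: measurableT_comp => //; apply: measurable_funM => //.
rewrite (eq_integral (fun x : measurableTypeR R =>
   v^-1%:E * (normal_pdf 0 v^-1 x)%:E)%E); last first.
  move=> x _; rewrite -EFinM !normal_pdfE ?invr_eq0 ?gt_eqF ?oner_eq0//.
  rewrite !normal_peak_gt0E ?invr_gt0// invr1 invrK mul1r.
  rewrite /normal_fun -(mulrA v) mulKf ?gt_eqF// mulrCA -expRD; congr (_ * expR _)%:E.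
  rewrite !subr0 expr1n exprVn v2; field.
  by rewrite gt_eqF.
rewrite ge0_integralZl//.
- by rewrite integral_normal_pdf mule1.
- by apply/measurable_EFinP; exact: measurable_normal_pdf.
- by move=> x _; rewrite lee_fin normal_pdf_ge0.
- by rewrite lee_fin invr_ge0 ltW.
Qed.

(** The fundamental theorem of calculus on [-n, n], and dominated convergence.
    Integrations by parts over the line are instances, with [h] the product of
    the two factors. *)
Lemma integral_derive_vanishing (h h' : R -> R) :
  (forall x : R, is_derive x (1 : R) h (h' x)) -> continuous h' ->
  mu.-integrable setT (EFin \o h') ->
  h n%:R @[n --> \oo] --> (0 : R) -> h (- n%:R) @[n --> \oo] --> (0 : R) ->
  (\int[mu]_x (h' x)%:E = 0)%E.
Proof.
move=> dh ch' ih' hp hm.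
have mh' : measurable_fun [set: measurableTypeR R] (EFin \o h') by exact: measurable_int ih'.
pose D (n : nat) : set R := `[- n%:R, n%:R]%classic.
pose f n := (EFin \o h') \_ (D n).
have c1 : (\int[mu]_x f n x)%E @[n --> \oo] --> (\int[mu]_x (h' x)%:E)%E.
  apply: (@dominated_cvg _ _ _ mu setT measurableT f _ (fun x => `|(h' x)%:E|%E)) => //.
  - move=> n; rewrite /f.
    have mD : measurable (D n : set (measurableTypeR R)) by exact: measurable_itv.
    by apply/(measurable_restrictT (EFin \o h') mD); exact: measurable_funTS.
  - move=> x _; apply: cvg_near_cst; near=> n.
    rewrite /f patchE mem_set// /D/= in_itv/=; apply/andP; split.
      rewrite lerNl (le_trans (ler_norm _))// normrN.
      by near: n; exact: nbhs_infty_ger.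
    rewrite (le_trans (ler_norm _))//.
    by near: n; exact: nbhs_infty_ger.
  - exact: integrable_abse.
  - by move=> n x _; rewrite /f patchE; case: ifPn => // _; rewrite abse0.
have c2 : (\int[mu]_x f n x)%E @[n --> \oo] --> (0 : \bar R)%E.
  have c3 : (h n%:R - h (- n%:R))%:E @[n --> \oo] --> (0 : \bar R)%E.
    apply: cvg_EFin; first exact: nearW.
    by rewrite -[0 in X in _ --> X](subr0 0); apply: cvgB.
  apply: cvg_trans c3; apply: near_eq_cvg; near=> n.
  rewrite /f -integral_mkcond.
  rewrite (@continuous_FTC2 _ h' h (- n%:R) n%:R)//.
  - have : (0 < n)%N by near: n; exact: nbhs_infty_gt.
    by rewrite -(ltr_nat R) => n0; lra.
  - exact: continuous_subspaceT.
  - have ch x : {for x, continuous h}.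
      by apply/differentiable_continuous/derivable1_diffP; have [] := dh x.
    split.
    + by move=> x _; have [] := dh x.
    + exact/cvg_at_right_filter/ch.
    + exact/cvg_at_left_filter/ch.
  - by move=> x _; rewrite derive1E; have [_ ->] := dh x.
exact: cvg_unique c1 c2.
Unshelve. all: end_near.
Qed.

(** Exponentials have finite normal integrals by [normal_mgf], and
    [expR x + expR (- x)] dominates both bounded functions and [x] itself. *)
Lemma integrable_normal_pdfM s (g : R -> R) (c : R) : s != 0 ->
  measurable_fun setT g -> (forall x, `|g x| <= c * (expR x + expR (- x))) ->
  mu.-integrable setT (fun x => (g x * normal_pdf 0 s x)%:E).
Proof.
move=> s0 mg gc.
have mpdf : measurable_fun [set: measurableTypeR R] (normal_pdf 0 s).
  exact: measurable_normal_pdf.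
have ie t : mu.-integrable setT (fun x : R => (expR (t * x) * normal_pdf 0 s x)%:E).
  apply/integrableP; split.
    by apply/measurable_EFinP/measurable_funM => //; exact: measurable_expRM.
  under eq_integral do rewrite /= ger0_norm ?mulr_ge0 ?expR_ge0 ?normal_pdf_ge0//.
  rewrite -ge0_integral_normal_prob//; last exact: measurable_expRM.
  by rewrite normal_mgf// ltry.
have iG := integrableZl measurableT c (integrableD measurableT (ie 1) (ie (-1))).
apply: (le_integrable measurableT _ _ iG) => //.
- exact/measurable_EFinP/measurable_funM.
- move=> x _; rewrite -EFinD -EFinM !abse_EFin lee_fin mul1r mulN1r -mulrDl mulrA.
  rewrite !normrM (ger0_norm (normal_pdf_ge0 _ _ _)).
  rewrite ler_wpM2r ?normal_pdf_ge0// -normrM.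
  by rewrite (le_trans (gc x))// ler_norm.
Qed.

Lemma is_derive_normal_pdf s x : s != 0 ->
  is_derive x (1 : R) (normal_pdf 0 s) (- (x / s ^+ 2) * normal_pdf 0 s x).
Proof.
move=> s0; rewrite normal_pdfE//.
rewrite /normal_fun; apply: is_derive_eq.
rewrite /GRing.scale/=; field.
by rewrite s0.
Qed.

(** The phase [th] makes this the real form of the characteristic function:
    [th = 0] and [th = - pi / 2] give its real and imaginary parts. *)
Definition normal_cf s th t := \int[mu]_x (cos (t * x + th) * normal_pdf 0 s x).

Lemma abs_le_expR (x : R) : `|x| <= expR x + expR (- x).
Proof.
have := expR_ge1Dx x; have := expR_ge1Dx (- x); have := expR_gt0 x.
have := expR_gt0 (- x); case: (ger0P x) => _; lra.
Qed.

Lemma one_le_expR (x : R) : 1 <= expR x + expR (- x).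
Proof.
have := expR_ge1Dx x; have := expR_ge1Dx (- x); have := expR_gt0 x.
have := expR_gt0 (- x); lra.
Qed.

Lemma measurable_cos : measurable_fun [set: R] (@cos R).
Proof. by apply: continuous_measurable_fun; exact: continuous_cos. Qed.
Lemma measurable_sin : measurable_fun [set: R] (@sin R).
Proof. by apply: continuous_measurable_fun; exact: continuous_sin. Qed.

(** Gaussian integration by parts: the centred normal density f satisfies
    - s^2 f' = x f, so the difference of the two integrands is the derivative of
    - s^2 sin(t x + th) f(x). *)
Lemma integral_xsin_normal_pdf s th t : s != 0 ->
  \int[mu]_x (x * sin (t * x + th) * normal_pdf 0 s x) =
  s ^+ 2 * t * normal_cf s th t.
Proof.
move=> s0.
pose h x := - s ^+ 2 * (sin (t * x + th) * normal_pdf 0 s x).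
pose h' x := x * sin (t * x + th) * normal_pdf 0 s x
   - s ^+ 2 * t * (cos (t * x + th) * normal_pdf 0 s x).
have ml : measurable_fun [set: R] (fun x : R => t * x + th).
  by apply: measurable_funD => //; exact: measurable_funM.
have ic : mu.-integrable setT (fun x : R => (cos (t * x + th) * normal_pdf 0 s x)%:E).
  apply: (@integrable_normal_pdfM s _ 1) => //.
    by apply: measurableT_comp => //; exact: measurable_cos.
  by move=> x; rewrite mul1r (le_trans _ (one_le_expR x))// ler_norml cos_geN1 cos_le1.
have is' : mu.-integrable setT (fun x : R => (x * sin (t * x + th) * normal_pdf 0 s x)%:E).
  apply: (@integrable_normal_pdfM s _ 1) => //.
    apply: measurable_funM => //; apply: measurableT_comp => //; exact: measurable_sin.
  move=> x; rewrite mul1r (le_trans _ (abs_le_expR x))// normrM ler_piMr//.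
  by rewrite ler_norml sin_geN1 sin_le1.
have ic2 : mu.-integrable setT (EFin \o (fun x : R => s ^+ 2 * t * (cos (t * x + th) * normal_pdf 0 s x))).
  by rewrite /comp; under eq_fun do rewrite EFinM; exact: integrableZl.
(* Quadratic decay of [h] suffices; it comes from [y <= expR y]. *)
have hb x : `|h x| * x ^+ 2 <= 2 * s ^+ 4 * normal_peak s.
  have s2 : 0 < s ^+ 2 by rewrite exprn_even_gt0.
  have [->|x0] := eqVneq x 0.
    rewrite expr0n mulr0; apply: mulr_ge0; last exact: normal_peak_ge0.
    by rewrite mulr_ge0// exprn_even_ge0.
  have -> : `|h x| = s ^+ 2 * (`|sin (t * x + th)| * normal_pdf 0 s x).
    rewrite /h normrM normrN (ger0_norm (ltW s2)); congr (_ * _).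
    by rewrite normrM (ger0_norm (normal_pdf_ge0 _ _ _)).
  rewrite normal_pdfE// /normal_fun subr0.
  have sin1 : `|sin (t * x + th)| <= 1 by rewrite ler_norml sin_geN1 sin_le1.
  have := expR_ge1Dx (x ^+ 2 / (s ^+ 2 *+ 2)).
  set E := expR _; rewrite mulNr expRN -/E => hE.
  have E0 : 0 < E by exact: expR_gt0.
  have x2 : x ^+ 2 <= 2 * s ^+ 2 * E.
    have : x ^+ 2 / (s ^+ 2 *+ 2) <= E by lra.
    rewrite ler_pdivrMr; last by rewrite mulrn_wgt0.
    by rewrite -mulr_natr; lra.
  have p0 := normal_peak_ge0 s.
  apply: (@le_trans _ _ (s ^+ 2 * (1 * (normal_peak s / E)) * x ^+ 2)).
    rewrite ler_wpM2r ?sqr_ge0// ler_wpM2l ?(ltW s2)// ler_wpM2r//.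
    by rewrite mulr_ge0 ?invr_ge0 ?(ltW E0).
  apply: (@le_trans _ _ (s ^+ 2 * (1 * (normal_peak s / E)) * (2 * s ^+ 2 * E))).
    by rewrite ler_wpM2l// mul1r mulr_ge0 ?sqr_ge0// divr_ge0// ltW.
  suff -> : s ^+ 2 * (1 * (normal_peak s / E)) * (2 * s ^+ 2 * E) =
      2 * s ^+ 4 * normal_peak s by [].
  by field; rewrite gt_eqF.
have hcvg (u : nat -> R) : (forall n, `|u n| = n%:R) -> h (u n) @[n --> \oo] --> (0 : R).
  move=> un; apply/norm_cvg0P; rewrite -cvg_shiftS/=.
  apply: (@squeeze_cvgr _ _ _ _ (cst 0)
    (fun n => 2 * s ^+ 4 * normal_peak s * harmonic n)).
  - apply: nearW => n /=; rewrite normr_ge0/= ler_pdivlMr//.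
    apply: le_trans (hb (u n.+1)); rewrite ler_wpM2l//.
    by rewrite -real_normK ?num_real// un expr2 ler_peMr// ler1n.
  - exact: cvg_cst.
  - rewrite -[0 in X in _ --> X](mulr0 (2 * s ^+ 4 * normal_peak s)).
    by apply: cvgMr; exact: cvg_harmonic.
have : (\int[mu]_x (h' x)%:E = 0)%E.
  have dpdf x := @is_derive_normal_pdf s x s0.
  apply: (@integral_derive_vanishing h).
  - move=> x; apply: is_derive_eq; rewrite /h' /GRing.scale/=; field.
    by rewrite s0.
  - move=> x; apply/differentiable_continuous/derivable1_diffP.
    rewrite /h'; exact: ex_derive.
  - by apply: eq_integrable (integrableB measurableT is' ic2) => // x _.
  - by apply: (hcvg (fun n => n%:R)) => n; rewrite normr_nat.
  - by apply: (hcvg (fun n => - n%:R)) => n; rewrite normrN normr_nat.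
move=> h0; apply/eqP; rewrite -subr_eq0; apply/eqP.
rewrite /normal_cf -RintegralZl// -RintegralB//.
by rewrite /Rintegral h0.
Qed.

(** Differentiation under the integral sign, with [|x|] times the density as
    dominating function; [integral_xsin_normal_pdf] then closes the differential
    equation. *)
Lemma is_derive_normal_cf s th t : s != 0 ->
  is_derive t (1 : R) (normal_cf s th) (- (s ^+ 2 * t * normal_cf s th t)).
Proof.
move=> s0.
pose f (t x : R) := cos (t * x + th) * normal_pdf 0 s x.
pose G (x : R) := `|x| * normal_pdf 0 s x.
have ml u : measurable_fun [set: R] (fun x : R => u * x + th).
  by apply: measurable_funD => //; exact: measurable_funM.
have If u : mu.-integrable setT (EFin \o f u).
  apply: (@integrable_normal_pdfM s _ 1) => //.
    by apply: measurableT_comp => //; exact: measurable_cos.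
  by move=> x; rewrite mul1r (le_trans _ (one_le_expR x))// ler_norml cos_geN1 cos_le1.
have IG : mu.-integrable setT (EFin \o G).
  apply: (@integrable_normal_pdfM s _ 1) => //.
  by move=> x; rewrite mul1r normr_id abs_le_expR.
have IS : mu.-integrable setT (EFin \o (fun x : R => x * sin (t * x + th) * normal_pdf 0 s x)).
  apply: (@integrable_normal_pdfM s _ 1) => //.
    apply: measurable_funM => //; apply: measurableT_comp => //; exact: measurable_sin.
  move=> x; rewrite mul1r (le_trans _ (abs_le_expR x))// normrM ler_piMr//.
  by rewrite ler_norml sin_geN1 sin_le1.
have df (x y : R) : is_derive x (1 : R) (f ^~ y) (- (y * sin (x * y + th) * normal_pdf 0 s y)).
  by apply: is_derive_eq; rewrite /GRing.scale/=; ring.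
have d1f (x y : R) : partial1of2 f x y = - (y * sin (x * y + th) * normal_pdf 0 s y).
  by rewrite /partial1of2 derive1E; have [_ ->] := df x y.
have G0 y : 0 <= G y by rewrite mulr_ge0// normal_pdf_ge0.
have tI : (`]t - 1, t + 1[%classic : set R) t by rewrite /= in_itv/=; apply/andP; split; lra.
have dG x y : `|partial1of2 f x y| <= G y.
  rewrite d1f normrN !normrM (ger0_norm (normal_pdf_ge0 _ _ _)).
  rewrite ler_wpM2r ?normal_pdf_ge0// ler_piMr//.
  by rewrite ler_norml sin_geN1 sin_le1.
have der := @derivable_under_integral R _ _ mu f setT measurableT t (t - 1) (t + 1)
  tI (fun x _ => If x) (fun x y _ _ => @ex_derive _ _ _ _ _ _ _ (df x y)) G G0 IG (fun x y _ _ => dG x y).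
have val := @differentiation_under_integral R _ _ mu f setT measurableT t (t - 1) (t + 1)
  tI (fun x _ => If x) (fun x y _ _ => @ex_derive _ _ _ _ _ _ _ (df x y)) G G0 IG (fun x y _ _ => dG x y).
apply: DeriveDef; first exact: der.
rewrite -derive1E [LHS]val -integral_xsin_normal_pdf// -mulN1r -RintegralZl//.
by apply: eq_Rintegral => y _; rewrite d1f mulN1r.
Qed.

(** By [is_derive_normal_cf] the product of the transform with
    [expR (t ^+ 2 * s ^+ 2 / 2)] has derivative zero in [t]. *)
Lemma normal_cfE s th t : s != 0 ->
  normal_cf s th t = cos th * expR (- (t ^+ 2 * s ^+ 2 / 2)).
Proof.
move=> s0.
pose g (t : R) := normal_cf s th t * expR (t ^+ 2 * s ^+ 2 / 2).
have dcf x := @is_derive_normal_cf s th x s0.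
have dg x : is_derive x (1 : R) g 0.
  by apply: is_derive_eq; rewrite /GRing.scale/=; field.
have gt : g t = cos th.
  rewrite (is_derive_0_is_cst t 0 dg) /g expr0n !mul0r expR0 mulr1 /normal_cf.
  under eq_Rintegral do rewrite mul0r add0r.
  rewrite RintegralZl//; last exact: integrable_normal_pdf.
  by rewrite /Rintegral integral_normal_pdf mulr1.
by rewrite -gt /g -[RHS]mulrA -expRD subrr expR0 mulr1.
Qed.

(** The summand 1 makes the integrand nonnegative, which is what the change of
    variables formulas for nonnegative functions need. *)
Lemma normal_prob_cos1 s th t : s != 0 ->
  (\int[normal_prob 0 s]_x (cos (t * x + th) + 1)%:E =
   (cos th * expR (- (t ^+ 2 * s ^+ 2 / 2)) + 1)%:E)%E.
Proof.
move=> s0.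
have mc : measurable_fun [set: R] (fun x : R => cos (t * x + th)).
  apply: measurableT_comp => //; first exact: measurable_cos.
  by apply: measurable_funD => //; exact: measurable_funM.
have ic : mu.-integrable setT (fun x : R => (cos (t * x + th) * normal_pdf 0 s x)%:E).
  apply: (@integrable_normal_pdfM s _ 1) => //.
  by move=> x; rewrite mul1r (le_trans _ (one_le_expR x))// ler_norml cos_geN1 cos_le1.
have ip := integrable_normal_pdf 0 s.
rewrite ge0_integral_normal_prob//; last by apply: measurable_funD.
rewrite -normal_cfE// /normal_cf.
under eq_integral do rewrite mulrDl mul1r EFinD.
rewrite integralD// [RHS]EFinD; congr (_ + _)%E; last exact: integral_normal_pdf.
by rewrite /Rintegral fineK//; exact: integrable_fin_num.
Qed.

End normal_integrals.

(** * Centred normal random variables *)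

Section expectation_tools.
Context {R : realType} d (Omega : measurableType d) (P : probability Omega R).

Lemma bounded_integrable (f : Omega -> R) (c : R) :
  measurable_fun setT f -> (forall w, `|f w| <= c) ->
  P.-integrable setT (EFin \o f).
Proof.
move=> mf fc; apply: measurable_bounded_integrable => //.
  by rewrite -ge0_fin_numE// fin_num_measure.
exists c; split; first exact: num_real.
by move=> x cx w _ /=; rewrite (le_trans (fc w))// ltW.
Qed.

Lemma measurable_set_le (f : Omega -> R) c :
  measurable_fun setT f -> measurable [set w | f w <= c].
Proof.
move=> mf; rewrite -[X in measurable X]setTI.
rewrite (_ : mkset _ = f @^-1` `]-oo, c]%classic); first exact: mf.
by apply/seteqP; split => w /=; rewrite in_itv.
Qed.

Lemma measurable_set_ge (f : Omega -> R) c :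
  measurable_fun setT f -> measurable [set w | c <= f w].
Proof.
move=> mf; rewrite -[X in measurable X]setTI.
rewrite (_ : mkset _ = f @^-1` `[c, +oo[%classic); first exact: mf.
by apply/seteqP; split => w /=; rewrite in_itv/= andbT.
Qed.

Lemma integrable_expRM (L : Omega -> R) t c : measurable_fun setT L ->
  (\int[P]_w (expR (t * L w))%:E = c%:E)%E ->
  P.-integrable setT (fun w => (expR (t * L w))%:E).
Proof.
move=> mL E; apply/integrableP; split.
  by apply/measurable_EFinP; apply: measurableT_comp => //; exact: measurable_funM.
by under eq_integral do rewrite /= ger0_norm ?expR_ge0//; rewrite E ltry.
Qed.

Lemma integrableD_EFin (f g : Omega -> R) :
  P.-integrable setT (EFin \o f) -> P.-integrable setT (EFin \o g) ->
  P.-integrable setT (EFin \o (fun w => f w + g w)).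
Proof. by move=> If Ig; exact: (integrableD measurableT If Ig). Qed.

Lemma integrableZ_EFin (c : R) (f : Omega -> R) :
  P.-integrable setT (EFin \o f) ->
  P.-integrable setT (EFin \o (fun w => c * f w)).
Proof. by move=> If; exact: (integrableZl measurableT c If). Qed.

Lemma integrableB_EFin (f g : Omega -> R) :
  P.-integrable setT (EFin \o f) -> P.-integrable setT (EFin \o g) ->
  P.-integrable setT (EFin \o (fun w => f w - g w)).
Proof. by move=> If Ig; exact: (integrableB measurableT If Ig). Qed.

Lemma integrable_cst_EFin (c : R) :
  P.-integrable setT (EFin \o (fun _ : Omega => c)).
Proof. exact: finite_measure_integrable_cst. Qed.

Lemma Rintegral_prob_cst (c : R) : \int[P]_w c = c.
Proof. by rewrite Rintegral_cst//= probability_setT mulr1. Qed.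

Lemma Rintegral_finsum (J : finType) (f : J -> Omega -> R) :
  (forall j, P.-integrable setT (EFin \o f j)) ->
  P.-integrable setT (EFin \o (fun w => \sum_j f j w)) /\
  \int[P]_w (\sum_j f j w) = \sum_j \int[P]_w f j w.
Proof.
move=> If; elim: (index_enum J) => [|j s [I1 I2]].
  split.
    rewrite (_ : (fun _ => _) = cst 0); first exact: integrable_cst_EFin.
    by apply/funext => w; rewrite big_nil.
  by rewrite big_nil -[RHS]Rintegral_prob_cst; apply: eq_Rintegral => w _; rewrite big_nil.
have E : (fun w => \sum_(i <- j :: s) f i w) = (fun w => f j w + \sum_(i <- s) f i w).
  by apply/funext => w; rewrite big_cons.
by rewrite E big_cons -I2; split; [exact: integrableD_EFin|rewrite RintegralD].
Qed.

Lemma EFin_Rintegral (f : Omega -> R) : P.-integrable setT (EFin \o f) ->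
  (\int[P]_w (f w)%:E = (\int[P]_w f w)%:E)%E.
Proof. by move=> If; rewrite /Rintegral fineK//; exact: integrable_fin_num. Qed.

End expectation_tools.

Section centered_normal.
Context {R : realType} d (Omega : measurableType d) (P : probability Omega R).

(** N(0, v) is encoded by its two transforms rather than by its law: this covers
    the degenerate case [v = 0] uniformly, and both transforms of a linear
    combination of jointly normal variables can be read off its variance. *)
Definition centered_normal (L : Omega -> R) (v : R) : Prop :=
  [/\ measurable_fun setT L, 0 <= v,
    forall t, (\int[P]_w (expR (t * L w))%:E = (expR (t ^+ 2 * v / 2))%:E)%E &
    forall t th, \int[P]_w cos (t * L w + th) = cos th * expR (- (t ^+ 2 * v / 2))].

Section law.
Variables (L : Omega -> R) (m s : R).
Hypothesis mL : measurable_fun setT L.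
Hypothesis lawL : forall A, measurable A -> P (L @^-1` A) = gaussian_law m s A.

(** Transfer of expectations to the law of [L]. For [s = 0] that law is a Dirac
    mass. *)
Lemma ge0_gaussian_law_integral (f : R -> R) :
  measurable_fun setT f -> (forall x, 0 <= f x) ->
  (\int[P]_w (f (L w))%:E =
   if (s == 0)%R then (f m)%:E else \int[normal_prob m s]_x (f x)%:E)%E.
Proof.
move=> mf f0.
have mEf : measurable_fun [set: measurableTypeR R] (EFin \o f) by exact/measurable_EFinP.
transitivity (\int[pushforward P (L : Omega -> measurableTypeR R)]_x (f x)%:E)%E.
  by rewrite ge0_integral_pushforward// => x _; rewrite lee_fin.
have [s0|s0] := eqVneq s 0.
  rewrite (eq_measure_integral (\d_ (m : measurableTypeR R))); last first.
    by move=> A mA _; have := lawL mA; rewrite /gaussian_law s0 eqxx.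
  by rewrite integral_dirac// diracT mul1e.
apply: eq_measure_integral => A mA _.
by have := lawL mA; rewrite /gaussian_law (negbTE s0).
Qed.

Lemma gaussian_law_mgf t :
  (\int[P]_w (expR (t * L w))%:E = (expR (t * m + t ^+ 2 * s ^+ 2 / 2))%:E)%E.
Proof.
rewrite (ge0_gaussian_law_integral (measurable_expRM t))//.
have [->|s0] := eqVneq s 0; last exact: normal_mgf.
by rewrite expr0n/= mulr0 mul0r addr0.
Qed.

Lemma gaussian_law_integrable : P.-integrable setT (EFin \o L).
Proof.
have iE t := integrable_expRM mL (gaussian_law_mgf t).
apply: (le_integrable measurableT _ _ (integrableD measurableT (iE 1) (iE (-1)))).
  exact/measurable_EFinP.
move=> w _; rewrite -EFinD !abse_EFin lee_fin mul1r mulN1r.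
by rewrite (le_trans (abs_le_expR (L w)))// ler_norm.
Qed.

(** From [1 + t L <= expR (t L)] and E L = 0 one gets
    0 <= t m + t^2 s^2 / 2 for every [t], which fails for some [t] unless
    m = 0. *)
Lemma gaussian_law_mean0 : (\int[P]_w (L w)%:E = 0)%E -> m = 0.
Proof.
move=> EL0; have iL := gaussian_law_integrable.
have iE t := integrable_expRM mL (gaussian_law_mgf t).
have key t : 0 <= t * m + t ^+ 2 * s ^+ 2 / 2.
  rewrite -[_ <= _](ler_expR 0) expR0 -lee_fin -gaussian_law_mgf.
  have <- : (\int[P]_w ((1%:E) + t%:E * (EFin \o L) w) = 1%:E)%E.
    rewrite integralD//; last 2 first.
    - exact: finite_measure_integrable_cst.
    - exact: integrableZl.
    by rewrite integralZl// EL0 mule0 adde0 integral_cst//= probability_setT mule1.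
  apply: le_integral => //.
    apply: integrableD => //; last exact: integrableZl.
    exact: finite_measure_integrable_cst.
  by move=> w _; rewrite -EFinM -EFinD lee_fin expR_ge1Dx.
have [s0|s0] := eqVneq s 0.
  have := key (- m); rewrite s0 expr0n/= mulr0 mul0r addr0 => h.
  by apply/eqP; rewrite -sqrf_eq0; apply/eqP; have := sqr_ge0 m; nra.
have := key (- m / s ^+ 2).
have -> : - m / s ^+ 2 * m + (- m / s ^+ 2) ^+ 2 * s ^+ 2 / 2 = - ((m / s) ^+ 2 / 2).
  by field.
move=> h; have := sqr_ge0 (m / s) => h2.
have /eqP : (m / s) ^+ 2 = 0 by lra.
by rewrite sqrf_eq0 mulf_eq0 invr_eq0 (negbTE s0) orbF => /eqP.
Qed.

Lemma gaussian_law_centered_normal : (\int[P]_w (L w)%:E = 0)%E ->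
  centered_normal L (s ^+ 2).
Proof.
move=> EL0; have m0 := gaussian_law_mean0 EL0; split => //.
- exact: sqr_ge0.
- by move=> t; rewrite gaussian_law_mgf m0 mulr0 add0r.
move=> t th.
have ml : measurable_fun [set: R] (fun x : R => t * x + th).
  by apply: measurable_funD => //; exact: measurable_funM.
have mc : measurable_fun [set: R] (fun x : R => cos (t * x + th)).
  by apply: measurableT_comp => //; exact: measurable_cos.
have mcL : measurable_fun setT (fun w => cos (t * L w + th)).
  by apply: (measurableT_comp mc mL).
have icL : P.-integrable setT (EFin \o (fun w => cos (t * L w + th))).
  by apply: (@bounded_integrable _ _ _ _ _ 1) => // w; rewrite ler_norml cos_geN1 cos_le1.
have i1 : P.-integrable setT (EFin \o (fun w : Omega => 1 : R)).
  exact: finite_measure_integrable_cst.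
have mc1 : measurable_fun [set: R] (fun x : R => cos (t * x + th) + 1).
  by apply: measurable_funD.
have c1 x : 0 <= cos (t * x + th) + 1 by have := cos_geN1 (t * x + th); lra.
suff : \int[P]_w (cos (t * L w + th) + 1) =
    cos th * expR (- (t ^+ 2 * s ^+ 2 / 2)) + 1.
  rewrite RintegralD// Rintegral_prob_cst; lra.
rewrite /Rintegral (ge0_gaussian_law_integral mc1 c1).
have [s0|s0] := eqVneq s 0.
  by rewrite m0 s0 expr0n/= !mulr0 mul0r oppr0 expR0 mulr1 add0r.
by rewrite m0 normal_prob_cos1.
Qed.
End law.
End centered_normal.

Section elementary_inequalities.
Context {R : realType}.
Implicit Types x y : R.

Lemma normr_sin_le x : `|sin x| <= `|x|.
Proof.
wlog x0 : x / 0 <= x.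
  move=> h; have [/h//|x0] := leP 0 x.
  by rewrite -normrN -sinN -(normrN x) h// oppr_ge0 ltW.
have [|c _] := @MVT_segment R sin cos 0 x x0.
  by apply: continuous_subspaceT; exact: continuous_sin.
by rewrite sin0 !subr0 => ->; rewrite normrM ler_piMl// cos_max.
Qed.

Lemma cos_ge_parabola x : 1 - x ^+ 2 / 2 <= cos x.
Proof.
have -> : cos x = 1 - 2 * sin (x / 2) ^+ 2.
  have {1}-> : x = (x / 2) *+ 2 by rewrite -mulr_natr; field.
  rewrite cos_mulr2n cos2sin2 -mulr_natr; ring.
have : sin (x / 2) ^+ 2 <= (x / 2) ^+ 2.
  by rewrite -[leLHS]real_normK ?num_real// -[leRHS]real_normK ?num_real// lerXn2r ?nnegrE// normr_sin_le.
by rewrite expr_div_n; lra.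
Qed.

Lemma sinh_ge x : 0 <= x -> 2 * x <= expR x - expR (- x).
Proof.
move=> x0.
pose f y : R := expR y - expR (- y) - 2 * y.
have df (y : R) : is_derive y (1 : R) f (expR y + expR (- y) - 2).
  by apply: is_derive_eq; rewrite /GRing.scale/=; ring.
have [|c _] := @MVT_segment R f (fun y => expR y + expR (- y) - 2) 0 x x0.
  apply: continuous_subspaceT => y.
  by apply/differentiable_continuous/derivable1_diffP; have [] := df y.
have : 2 <= expR c + expR (- c).
  have h : expR c * expR (- c) = 1 by rewrite -expRD subrr expR0.
  have := expR_gt0 c; have := expR_gt0 (- c); have := sqr_ge0 (expR c - expR (- c)).
  nra.
rewrite /f oppr0 expR0 => c2 E.
have : 0 <= (expR c + expR (- c) - 2) * x by rewrite mulr_ge0// subr_ge0.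
lra.
Qed.

(** The identity exp x + exp (-x) - 2 = (exp (x/2) - exp (-x/2))^2 reduces the
    bound to [sinh_ge]. *)
Lemma cosh_ge x : 2 + x ^+ 2 <= expR x + expR (- x).
Proof.
wlog x0 : x / 0 <= x.
  move=> h; have [/h//|x0] := leP 0 x.
  by have := h (- x); rewrite sqrrN opprK oppr_ge0 (ltW x0) addrC [leRHS]addrC => ->.
have y0 : 0 <= x / 2 by rewrite divr_ge0.
have := sinh_ge y0; set p := expR (x / 2); set q := expR (- _) => h.
have -> : expR x = p ^+ 2 by rewrite -expRM_natl; congr expR; field.
have -> : expR (- x) = q ^+ 2 by rewrite -expRM_natl; congr expR; field.
have pq : p * q = 1 by rewrite -expRD subrr expR0.
have : x ^+ 2 <= (p - q) ^+ 2 by rewrite lerXn2r ?nnegrE//; lra.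
have -> : (p - q) ^+ 2 = p ^+ 2 + q ^+ 2 - 2 * (p * q) by ring.
rewrite pq; lra.
Qed.
End elementary_inequalities.

Section second_moment.
Context {R : realType} d (Omega : measurableType d) (P : probability Omega R).
Variables (L : Omega -> R) (v : R).
Hypothesis LN : centered_normal P L v.

Lemma centered_normal_integrable_sqr :
  P.-integrable setT (EFin \o (fun w => L w ^+ 2)).
Proof.
have [mL v0 mgf _] := LN.
have iE t := integrable_expRM mL (mgf t).
apply: (le_integrable measurableT _ _ (integrableD measurableT (iE 1) (iE (-1)))).
  by apply/measurable_EFinP; exact: measurable_funX.
move=> w _; rewrite -EFinD !abse_EFin lee_fin mul1r mulN1r ger0_norm ?sqr_ge0//.
by have := cosh_ge (L w); have := ler_norm (expR (L w) + expR (- L w)); lra.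
Qed.

(** Both transforms have second order expansions with coefficient [v], while
    [cosh_ge] and [cos_ge_parabola] bound them in terms of V = E L^2: with
    y = t^2 / 2, 1 + y V <= exp (y v) and 1 - y V <= exp (- y v). Letting y tend
    to 0 gives V <= v and v <= V. *)
Lemma centered_normal_variance : \int[P]_w (L w ^+ 2) = v.
Proof.
have [mL v0 mgf cf] := LN.
have i2 := centered_normal_integrable_sqr.
set V := \int[P]_w _.
have V0 : 0 <= V by apply: Rintegral_ge0 => w _; exact: sqr_ge0.
have i1 : P.-integrable setT (EFin \o (fun w : Omega => 1 : R)).
  exact: finite_measure_integrable_cst.
have iZ c : P.-integrable setT (EFin \o (fun w => c * L w ^+ 2)).
  by rewrite /comp; under eq_fun do rewrite EFinM; exact: integrableZl.
have up t : 1 + t ^+ 2 / 2 * V <= expR (t ^+ 2 * v / 2).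
  have iE u := integrable_expRM mL (mgf u).
  have -> : expR (t ^+ 2 * v / 2) = 2^-1 * \int[P]_w (expR (t * L w) + expR ((- t) * L w)).
    rewrite RintegralD//; last 2 first.
      exact: iE.
      exact: iE.
    by rewrite /Rintegral !mgf/= sqrrN; field.
  have -> : 1 + t ^+ 2 / 2 * V = 2^-1 * \int[P]_w (2 + t ^+ 2 * L w ^+ 2).
    rewrite RintegralD//; last exact: finite_measure_integrable_cst.
    by rewrite RintegralZl// Rintegral_prob_cst -/V; field.
  rewrite ler_wpM2l ?invr_ge0//; apply: le_Rintegral => //.
  - by apply: integrableD_EFin => //; exact: integrable_cst_EFin.
  - by apply: integrableD_EFin => //; exact: iE.
  - by move=> w _; rewrite -exprMn mulNr cosh_ge.
have lo t : 1 - t ^+ 2 / 2 * V <= expR (- (t ^+ 2 * v / 2)).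
  have := cf t 0; rewrite cos0 mul1r => <-.
  have -> : 1 - t ^+ 2 / 2 * V = \int[P]_w (1 - t ^+ 2 / 2 * L w ^+ 2).
    by rewrite RintegralB// RintegralZl// Rintegral_prob_cst.
  apply: le_Rintegral => //.
  - exact: integrableB_EFin.
  - apply: (@bounded_integrable _ _ _ _ _ 1) => [|w]; last exact: cos_max.
    apply: measurableT_comp => //; first exact: measurable_cos.
    by apply: measurable_funD => //; exact: measurable_funM.
  - move=> w _; rewrite addr0; have := cos_ge_parabola (t * L w).
    by rewrite exprMn; lra.
have key y : 0 < y -> 1 + y * V <= expR (y * v) /\ 1 - y * V <= expR (- (y * v)).
  move=> y0; have := up (Num.sqrt (2 * y)); have := lo (Num.sqrt (2 * y)).
  rewrite sqr_sqrtr ?mulr_ge0// ?(ltW y0)//.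
  have -> : 2 * y / 2 * V = y * V by field.
  by have -> : 2 * y * v / 2 = y * v by field.
apply/eqP; rewrite eq_le; apply/andP; split; rewrite leNgt; apply/negP => hv.
- have dV : 0 < V - v by rewrite subr_gt0.
  (* [y] is so small that [y ^+ 2 * V * v] stays below [y * (V - v)], which
     contradicts [(1 + y * V) * (1 - y * v) <= 1]. *)
  pose y := (V - v) / (2 * (V * v + 1)).
  have den : 0 < 2 * (V * v + 1) by rewrite mulr_gt0// ltr_wpDl// mulr_ge0.
  have y0 : 0 < y by rewrite divr_gt0.
  have yE : y * (2 * (V * v + 1)) = V - v by rewrite /y divfK// gt_eqF.
  have [h1 _] := key y y0.
  have h2 := expR_ge1Dx (- (y * v)).
  have h3 : expR (y * v) * expR (- (y * v)) = 1 by rewrite -expRD subrr expR0.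
  have e0 := expR_gt0 (y * v).
  have h4 : (1 + y * V) * (1 - y * v) <= 1.
    have [l0|l0] := leP 0 (1 - y * v).
      apply: (@le_trans _ _ (expR (y * v) * (1 - y * v))); first exact: ler_wpM2r.
      by rewrite -[X in _ <= X]h3 ler_wpM2l// ltW.
    have : 0 <= y * V by rewrite mulr_ge0// ltW.
    nra.
  have y2 : 0 < y ^+ 2 by rewrite exprn_gt0.
  have vV : 0 <= y ^+ 2 * (V * v) by apply: mulr_ge0; [exact: ltW|exact: mulr_ge0].
  have : (1 + y * V) * (1 - y * v) = 1 + y * (V - v) - y ^+ 2 * (V * v) by ring.
  by rewrite -yE; nra.
- have dV : 0 < v - V by rewrite subr_gt0.
  (* Symmetrically, the contradiction is with [(1 - y * V) * (1 + y * v) <= 1]. *)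
  pose y := (v - V) / (2 * (V * v + 1)).
  have den : 0 < 2 * (V * v + 1) by rewrite mulr_gt0// ltr_wpDl// mulr_ge0.
  have y0 : 0 < y by rewrite divr_gt0.
  have yE : y * (2 * (V * v + 1)) = v - V by rewrite /y divfK// gt_eqF.
  have [_ h1] := key y y0.
  have h2 := expR_ge1Dx (y * v).
  have h3 : expR (y * v) * expR (- (y * v)) = 1 by rewrite -expRD subrr expR0.
  have e0 := expR_gt0 (- (y * v)).
  have yv : 0 <= y * v by rewrite mulr_ge0// ltW.
  have h4 : (1 - y * V) * (1 + y * v) <= 1.
    apply: (@le_trans _ _ (expR (- (y * v)) * (1 + y * v))).
      by rewrite ler_wpM2r// addr_ge0.
    by rewrite -[X in _ <= X]h3 mulrC ler_wpM2r// ltW.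
  have y2 : 0 < y ^+ 2 by rewrite exprn_gt0.
  have vV : 0 <= y ^+ 2 * (V * v) by apply: mulr_ge0; [exact: ltW|exact: mulr_ge0].
  have : (1 - y * V) * (1 + y * v) = 1 + y * (v - V) - y ^+ 2 * (V * v) by ring.
  by rewrite -yE; nra.
Qed.
End second_moment.

(** * Laplace transforms of sums of squares *)

Section gaussian_linearization.
Context {R : realType} d (Omega : measurableType d) (P : probability Omega R).
Local Notation gamma := (@normal_prob R 0 1).

Lemma normal_prob_cos t : \int[gamma]_x cos (t * x) = expR (- (t ^+ 2 / 2)).
Proof.
have mc : measurable_fun [set: measurableTypeR R] (fun x : R => cos (t * x)).
  have ml : measurable_fun [set: R] (fun x : R => t * x) by exact: measurable_funM.
  exact: (measurableT_comp measurable_cos ml).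
have ic : (gamma : probability (measurableTypeR R) R).-integrable setT
    (EFin \o (fun x : R => cos (t * x))).
  by apply: (@bounded_integrable _ _ _ _ _ 1) => // x; exact: cos_max.
have : \int[gamma]_x (cos (t * x) + 1) = expR (- (t ^+ 2 / 2)) + 1.
  have h := @normal_prob_cos1 R 1 0 t (oner_neq0 R).
  rewrite cos0 mul1r expr1n mulr1 in h.
  rewrite /Rintegral; under eq_integral do rewrite -[t * _]addr0.
  by rewrite h.
rewrite RintegralD//; last exact: integrable_cst_EFin.
rewrite (Rintegral_prob_cst (gamma : probability (measurableTypeR R) R)).
by move/addIr.
Qed.

Variables (F L W : Omega -> R) (C lam s : R).
Hypothesis mF : measurable_fun setT F.
Hypothesis mL : measurable_fun setT L.
Hypothesis mW : measurable_fun setT W.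
Hypothesis s0 : 0 <= s.

(** The Hubbard-Stratonovich device: exp (- s W^2) is the mean of
    cos (sqrt (2 s) g W) over a standard normal g. By Fubini the quadratic weight
    becomes a normal average of phase shifts of [L] by multiples of [W], to which
    the hypothesis applies; the remaining average over g is
    [normal_square_mgf]. *)
Lemma cos_linearization :
  0 <= lam -> (exists K, forall w, `|F w| <= K) ->
  (forall b, \int[P]_w (F w * cos (L w + b * W w)) = C * expR (- (b ^+ 2 * lam / 2))) ->
  \int[P]_w (F w * expR (- (s * W w ^+ 2)) * cos (L w)) =
  C * (Num.sqrt (1 + 2 * (s * lam)))^-1.
Proof.
move=> lam0 [K FK] hyp.
set r := Num.sqrt (2 * s).
have r2 : r ^+ 2 = 2 * s by rewrite sqr_sqrtr// mulr_ge0.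
pose h (z : Omega * measurableTypeR R) := F z.1 * cos (L z.1) * cos (r * W z.1 * z.2).
have m1 (f : Omega -> R) : measurable_fun setT f ->
    measurable_fun [set: Omega * measurableTypeR R] (fun z => f z.1).
  by move=> mf; apply: measurableT_comp.
have mcos (d' : measure_display) (T : measurableType d') (f : T -> R) :
    measurable_fun setT f -> measurable_fun setT (fun x => cos (f x)).
  by move=> mf; apply: measurableT_comp => //; exact: measurable_cos.
have mh : measurable_fun setT h.
  apply: measurable_funM.
    by apply: measurable_funM; [exact: m1|apply: mcos; exact: m1].
  apply: mcos; apply: measurable_funM; last exact: measurable_snd.
  by apply: measurable_funM => //; exact: m1.
have bh z : `|h z| <= K.
  rewrite /h !normrM -mulrA -[leRHS]mulr1 ler_pM ?mulr_ge0//.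
  by rewrite mulr_ile1// cos_max.
have ih : (P \x (gamma : probability (measurableTypeR R) R))%E.-integrable setT (EFin \o h).
  apply/integrable12ltyP; first exact/measurable_EFinP.
  apply: (@le_lt_trans _ _ (\int[P]_x K%:E)%E); last first.
    by rewrite integral_cst//= probability_setT mule1 ltry.
  have mah : measurable_fun setT (fun z => `|(EFin \o h) z|%E).
    by apply: measurableT_comp => //; exact/measurable_EFinP.
  apply: ge0_le_integral => //.
  - by move=> w _; exact: integral_ge0.
  - exact: (measurable_fun_fubini_tonelli_F (m2 := (gamma : probability (measurableTypeR R) R)) _ mah).
  move=> w _; apply: (@le_trans _ _ (\int[gamma]_x K%:E)%E).
    apply: ge0_le_integral => //.
    + exact: (measurableT_comp mah (pair1_measurable w)).
    + by move=> x _; rewrite lee_fin bh.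
  rewrite integral_cst//= (@probability_setT _ _ _ (gamma : probability (measurableTypeR R) R)).
  by rewrite mule1.
have FF := Fubini ih.
have ic w : (gamma : probability (measurableTypeR R) R).-integrable setT
    (EFin \o (fun x : R => cos (r * W w * x))).
  apply: (@bounded_integrable _ _ _ _ _ 1) => // [|x]; last exact: cos_max.
  by apply: mcos; apply: measurable_funM.
have i1 w : (\int[gamma]_x (EFin \o h) (w, x))%E =
    (F w * expR (- (s * W w ^+ 2)) * cos (L w))%:E.
  rewrite /h /=; under eq_integral do rewrite EFinM.
  have E : (\int[gamma]_x (cos (r * W w * x))%:E =
      (expR (- ((r * W w) ^+ 2 / 2)))%:E)%E.
    by rewrite -normal_prob_cos; exact: (EFin_Rintegral (ic w)).
  rewrite (integralZl measurableT (ic w)).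
  rewrite [X in (_ * X)%E]E -EFinM exprMn r2.
  have -> : 2 * s * W w ^+ 2 / 2 = s * W w ^+ 2 by field.
  by rewrite mulrAC.
have iF b : P.-integrable setT (EFin \o (fun w => F w * cos (L w + b * W w))).
  apply: (@bounded_integrable _ _ _ _ _ K) => [|w].
    apply: measurable_funM => //; apply: mcos; apply: measurable_funD => //.
    exact: measurable_funM.
  by rewrite normrM -[leRHS]mulr1 ler_pM// cos_max.
have i2 x : (\int[P]_w (EFin \o h) (w, x))%E = (C * expR (- (s * lam) * x ^+ 2))%:E.
  have E w : h (w, x) = 2^-1 * (F w * cos (L w + (r * x) * W w) + F w * cos (L w + (- (r * x)) * W w)).
    rewrite /h /= mulNr !cosD cosN sinN.
    have -> : r * W w * x = r * x * W w by ring.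
    by field.
  transitivity (\int[P]_w (2^-1 * (F w * cos (L w + (r * x) * W w) + F w * cos (L w + (- (r * x)) * W w)))%:E)%E.
    by apply: eq_integral => w _; rewrite /comp E.
  rewrite EFin_Rintegral; last by apply: integrableZ_EFin; apply: integrableD_EFin.
  rewrite RintegralZl//; last exact: integrableD_EFin.
  rewrite RintegralD// !hyp sqrrN exprMn r2; congr EFin.
  have -> : - (2 * s * x ^+ 2 * lam / 2) = - (s * lam) * x ^+ 2 by field.
  by field.
rewrite /Rintegral.
under eq_integral do rewrite -i1.
rewrite FF.
under eq_integral do rewrite i2 EFinM.
have sl : 0 <= s * lam by exact: mulr_ge0.
have sq : (\int[gamma]_x (expR (- (s * lam) * x ^+ 2))%:E =
    ((Num.sqrt (1 + 2 * (s * lam)))^-1)%:E)%E.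
  rewrite normal_square_mgf; last lra.
  by rewrite mulrN opprK.
rewrite integralZl//; first by rewrite sq.
apply/integrableP; split.
  apply/measurable_EFinP; apply: measurableT_comp => //; apply: measurable_funM => //.
under eq_integral do rewrite /= ger0_norm ?expR_ge0//.
by rewrite sq ltry.
Qed.

(** The same device with exp (s W^2), which is the mean of exp (sqrt (2 s) g W).
    All integrands are nonnegative, so Tonelli's theorem replaces Fubini's. *)
Lemma exp_linearization : 0 <= C -> 2 * (s * lam) < 1 ->
  (forall w, 0 <= F w) ->
  (forall b, \int[P]_w (F w * expR (L w + b * W w))%:E =
     (C * expR (b ^+ 2 * lam / 2))%:E)%E ->
  (\int[P]_w (F w * expR (s * W w ^+ 2) * expR (L w))%:E =
  (C * (Num.sqrt (1 - 2 * (s * lam)))^-1)%:E)%E.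
Proof.
move=> C0 slam F0 hyp.
set r := Num.sqrt (2 * s).
have r2 : r ^+ 2 = 2 * s by rewrite sqr_sqrtr// mulr_ge0.
pose h (z : Omega * measurableTypeR R) := (F z.1 * expR (L z.1) * expR (r * W z.1 * z.2))%:E.
have m1 (f : Omega -> R) : measurable_fun setT f ->
    measurable_fun [set: Omega * measurableTypeR R] (fun z => f z.1).
  by move=> mf; apply: measurableT_comp.
have mexp (d' : measure_display) (T : measurableType d') (f : T -> R) :
    measurable_fun setT f -> measurable_fun setT (fun x => expR (f x)).
  by move=> mf; apply: measurableT_comp.
have mh : measurable_fun setT h.
  apply/measurable_EFinP; apply: measurable_funM.
    by apply: measurable_funM; [exact: m1|apply: mexp; exact: m1].
  apply: mexp; apply: measurable_funM; last exact: measurable_snd.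
  by apply: measurable_funM => //; exact: m1.
have h0 z : (0 <= h z)%E by rewrite lee_fin !mulr_ge0 ?expR_ge0.
have FF := @fubini_tonelli _ _ _ _ R P (gamma : probability (measurableTypeR R) R) h mh h0.
have i1 w : (\int[gamma]_x h (w, x))%E =
    (F w * expR (s * W w ^+ 2) * expR (L w))%:E.
  rewrite /h /=; under eq_integral do rewrite EFinM.
  rewrite ge0_integralZl//; last 2 first.
  - by apply/measurable_EFinP; exact: measurable_expRM.
  - by rewrite lee_fin mulr_ge0 ?expR_ge0.
  rewrite normal_mgf ?oner_eq0// -EFinM mulr0 add0r exprMn r2.
  have -> : 2 * s * W w ^+ 2 * 1 ^+ 2 / 2 = s * W w ^+ 2 by rewrite expr1n; field.
  by rewrite mulrAC.
have i2 x : (\int[P]_w h (w, x))%E = (C * expR (s * lam * x ^+ 2))%:E.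
  transitivity (\int[P]_w (F w * expR (L w + r * x * W w))%:E)%E.
    apply: eq_integral => w _; rewrite /h /= -mulrA -expRD; congr (_ * expR _)%:E.
    by ring.
  by rewrite hyp exprMn r2; congr (_ * expR _)%:E; field.
under eq_integral do rewrite -i1.
rewrite FF.
under eq_integral do rewrite i2 EFinM.
rewrite ge0_integralZl//; last by apply/measurable_EFinP; apply: mexp; apply: measurable_funM.
by rewrite normal_square_mgf//; lra.
Qed.

End gaussian_linearization.

Section independent_squares.
Context {R : realType} d (Omega : measurableType d) (P : probability Omega R).
Variables (W : nat -> Omega -> R) (lam : nat -> R) (s : R).
Hypothesis mW : forall k, measurable_fun setT (W k).
Hypothesis s0 : 0 <= s.
Hypothesis lam0 : forall k, 0 <= lam k.

Let mlin n (a : nat -> R) : measurable_fun setT (fun w => \sum_(k < n) a k * W k w).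
Proof. by apply: measurable_sum => k; exact: measurable_funM. Qed.

Let ext n (a : nat -> R) (b : R) k := if k == n then b else a k.

Let ext_sum n a b (f : nat -> R -> R) :
  \sum_(k < n.+1) f k (ext n a b k) = \sum_(k < n) f k (a k) + f n b.
Proof.
rewrite big_ord_recr/= /ext eqxx; congr (_ + _).
by apply: eq_bigr => k _; rewrite ltn_eqF.
Qed.

(** Joint normality of uncorrelated variables enters through their joint
    characteristic function only. The induction uses [cos_linearization] to
    absorb one factor [expR (- (s * W n w ^+ 2))] into [F], whose generality is
    there for this purpose. *)
Lemma laplace_squares_neg n (F : Omega -> R) (C : R) :
  measurable_fun setT F -> (exists K, forall w, `|F w| <= K) ->
  (forall a : nat -> R, \int[P]_w (F w * cos (\sum_(k < n) a k * W k w)) =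
     C * expR (- (\sum_(k < n) a k ^+ 2 * lam k / 2))) ->
  \int[P]_w (F w * expR (- (s * \sum_(k < n) W k w ^+ 2))) =
  C * \prod_(k < n) (Num.sqrt (1 + 2 * (s * lam k)))^-1.
Proof.
elim: n F C => [|n IH] F C mF bF hyp.
  have := hyp (fun=> 0); rewrite !big_ord0 oppr0 expR0 mulr1 => <-.
  by apply: eq_Rintegral => w _; rewrite !big_ord0 mulr0 oppr0 expR0 cos0.
rewrite big_ord_recr/= (mulrC (\prod_(i < n) _)) (mulrA C).
rewrite -(IH (fun w => F w * expR (- (s * W n w ^+ 2)))).
- apply: eq_Rintegral => w _; rewrite big_ord_recr/= mulrDr opprD addrC expRD.
  by rewrite mulrA.
- apply: measurable_funM => //; apply: measurableT_comp => //.
  apply: measurableT_comp => //; apply: measurable_funM => //.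
  exact: measurable_funX.
- have [K FK] := bF; exists K => w; rewrite normrM -[leRHS]mulr1 ler_pM//.
  by rewrite ger0_norm ?expR_ge0// expR_le1 oppr_le0 mulr_ge0// sqr_ge0.
- move=> a; rewrite mulrAC.
  apply: cos_linearization => // b.
  have := hyp (ext n a b).
  rewrite (ext_sum n a b (fun k x => x ^+ 2 * lam k / 2)) opprD expRD mulrA => <-.
  apply: eq_Rintegral => w _.
  by rewrite (ext_sum n a b (fun k x => x * W k w)).
Qed.

(** As for [laplace_squares_neg], with the joint moment generating function and
    [exp_linearization]. *)
Lemma laplace_squares_pos n (F : Omega -> R) (C : R) :
  (forall k, 2 * (s * lam k) < 1) ->
  measurable_fun setT F -> (forall w, 0 <= F w) -> 0 <= C ->
  (forall a : nat -> R, (\int[P]_w (F w * expR (\sum_(k < n) a k * W k w))%:E =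
     (C * expR (\sum_(k < n) a k ^+ 2 * lam k / 2))%:E)%E) ->
  (\int[P]_w (F w * expR (s * \sum_(k < n) W k w ^+ 2))%:E =
  (C * \prod_(k < n) (Num.sqrt (1 - 2 * (s * lam k)))^-1)%:E)%E.
Proof.
move=> sl; elim: n F C => [|n IH] F C mF F0 C0 hyp.
  have := hyp (fun=> 0); rewrite !big_ord0 expR0 mulr1 => <-.
  by apply: eq_integral => w _; rewrite !big_ord0 mulr0 expR0.
rewrite big_ord_recr/= (mulrC (\prod_(i < n) _)) (mulrA C).
rewrite -(IH (fun w => F w * expR (s * W n w ^+ 2))).
- apply: eq_integral => w _; rewrite big_ord_recr/= mulrDr addrC expRD.
  by rewrite mulrA.
- apply: measurable_funM => //; apply: measurableT_comp => //.
  by apply: measurable_funM => //; exact: measurable_funX.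
- by move=> w; rewrite mulr_ge0 ?expR_ge0.
- by rewrite mulr_ge0// invr_ge0.
- move=> a; rewrite mulrAC.
  apply: exp_linearization => //; first by rewrite mulr_ge0 ?expR_ge0.
  move=> b; have := hyp (ext n a b).
  rewrite (ext_sum n a b (fun k x => x ^+ 2 * lam k / 2)) expRD mulrA => <-.
  apply: eq_integral => w _.
  by rewrite (ext_sum n a b (fun k x => x * W k w)).
Qed.
End independent_squares.

(** * Spectral theorem for real symmetric matrices *)

Section spectral.
Context {R : realType}.

(** For a complex eigenvector [v] of eigenvalue [a], with conjugate transpose w,
    a (v w) = v A w; here v w > 0, and v A w is its own conjugate because [A] is
    real symmetric. So [a] is real. *)
Lemma real_sym_eigenvalue n (A : 'M[R]_n.+1) : A^T = A -> exists a, eigenvalue A a.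
Proof.
move=> symA.
pose f := real_complex R.
have [a ea] := @spectral.eigenvalue_closed _ _ (map_mx f A) (ltn0Sn n).
have [v /rowP hv v0] := eigenvalueP ea.
have aR : (a^* = a)%C.
  pose s := \sum_i v 0 i * (v 0 i)^*%C.
  have s0 : s != 0.
    have sge (i : 'I_n.+1) : 0 <= v 0 i * (v 0 i)^*%C by exact: mul_conjC_ge0.
    apply/negP => /eqP /psumr_eq0P h.
    case/negP: v0; apply/eqP/rowP => i; rewrite mxE.
    have := h (fun i _ => sge i) i isT.
    by move/eqP; rewrite mul_conjC_eq0 => /eqP.
  have e1 : a * s = \sum_j \sum_i v 0 i * (A i j)%:C%C * (v 0 j)^*%C.
    rewrite /s mulr_sumr; apply: eq_bigr => j _.
    have := hv j; rewrite !mxE mulrA => <-; rewrite mulr_suml.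
    by apply: eq_bigr => i _; rewrite !mxE.
  have e2 : (a * s)^*%C = a * s.
    rewrite e1 rmorph_sum exchange_big/=; apply: eq_bigr => j _.
    rewrite rmorph_sum; apply: eq_bigr => i _.
    rewrite !rmorphM /= conjcK.
    have -> : A j i = A i j by rewrite -[in LHS]symA mxE.
    by rewrite oppr0 [LHS]mulrC mulrA mulrAC.
  have e3 : s^*%C = s.
    rewrite /s rmorph_sum; apply: eq_bigr => i _.
    by rewrite rmorphM /= conjcK mulrC.
  move: e2; rewrite rmorphM /= e3 => /mulIf; exact.
have fa : f (complex.Re a) = a.
  case: a aR {ea hv} => x y /= [yy].
  by congr Complex; lra.
exists (complex.Re a).
rewrite eigenvalue_root_char -(fmorph_root f) map_char_poly.
rewrite -eigenvalue_root_char.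
exact: (eq_ind_r (fun z => eigenvalue (map_mx f A) z) ea fa).
Qed.

(** The reflection in the hyperplane orthogonal to [v - e], with [e] the first
    basis vector, exchanges [v] and [e]. *)
Lemma householder n (v : 'rV[R]_n.+1) : v *m v^T = 1 ->
  exists H : 'M[R]_n.+1, H *m H^T = 1%:M /\ row 0 H = v.
Proof.
move=> v1.
pose e : 'rV[R]_n.+1 := delta_mx 0 0.
have e1 : e *m e^T = 1.
  by rewrite /e trmx_delta mul_delta_mx; apply/matrixP => i j; rewrite !mxE !ord1.
have [ve|ve] := eqVneq v e.
  exists 1%:M; rewrite trmx1 mulmx1; split=> //.
  by rewrite row1 ve.
pose w := v - e.
pose c := (w *m w^T) 0 0.
have wc : w *m w^T = c%:M by rewrite -mx11_scalar.
pose b := v 0 0.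
have ev : e *m v^T = b%:M.
  by rewrite /e -rowE; apply/matrixP => i j; rewrite !mxE !ord1.
have ve' : v *m e^T = b%:M.
  by apply: trmx_inj; rewrite trmx_mul trmxK ev tr_scalar_mx.
have cE : c%:M = (2 - 2 * b)%:M :> 'M[R]_1.
  rewrite -wc /w linearB/= mulmxBl !mulmxBr v1 e1 ev ve'.
  by apply/matrixP => i j; rewrite !mxE !ord1 eqxx !mulr1n; ring.
have c0 : c != 0.
  rewrite /c mxE; apply/negP => /eqP/psumr_eq0P h.
  case/negP: ve; rewrite -subr_eq0; apply/eqP/rowP => i; rewrite [RHS]mxE.
  have h0 (j : 'I_n.+1) : true -> 0 <= w 0 j * w^T j 0 by rewrite [w^T _ _]mxE -expr2 sqr_ge0.
  have := h h0 i isT; rewrite [w^T _ _]mxE => /eqP; rewrite -expr2 sqrf_eq0.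
  by move/eqP.
pose H := 1%:M - (2 / c) *: (w^T *m w).
have HT : H^T = H by rewrite /H linearB/= linearZ/= trmx_mul trmxK trmx1.
exists H; rewrite HT; split.
  have ww : (w^T *m w) *m (w^T *m w) = c *: (w^T *m w).
    by rewrite mulmxA -(mulmxA _ w) wc mul_mx_scalar -scalemxAl.
  rewrite /H; move: (w^T *m w) ww => G ww.
  rewrite mulmxBl !mulmxBr !mul1mx !mulmx1 -scalemxAl -scalemxAr ww !scalerA.
  have -> : 2 / c * (2 / c) * c = 2 / c + 2 / c by field.
  by rewrite scalerDl; apply/matrixP => i j; rewrite !mxE; ring.
rewrite rowE -/e /H mulmxBr mulmx1 -scalemxAr mulmxA.
have -> : e *m w^T = (b - 1)%:M.
  rewrite /w linearB/= mulmxBr ev e1.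
  by apply/matrixP => i j; rewrite !mxE !ord1 eqxx.
rewrite mul_scalar_mx scalerA.
have cb : c = 2 - 2 * b by have /matrixP/(_ 0 0) := cE; rewrite !mxE.
have -> : 2 / c * (b - 1) = -1.
  have -> : b - 1 = - (c / 2) by rewrite cb; field.
  by field.
by rewrite scaleN1r opprK /w addrC subrK.
Qed.

Lemma block_first_row n (B : 'M[R]_(1 + n)) a : B^T = B ->
  row 0 B = a *: delta_mx 0 0 -> B = block_mx a%:M 0 0 (drsubmx B).
Proof.
move=> symB rB.
have B0 j : B 0 j = a *+ (j == 0).
  have /rowP/(_ j) := rB; rewrite mxE => ->.
  by rewrite !mxE eqxx/= mulr_natr.
have B0' j : B j 0 = a *+ (j == 0) by rewrite -B0 -[in LHS]symB mxE.
have l0 : lshift n (0 : 'I_1) = 0 by apply/val_inj.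
rewrite -[LHS]submxK; congr block_mx; apply/matrixP => i j; rewrite !mxE ?ord1 l0.
- by rewrite B0 eqxx.
- by rewrite B0.
- by rewrite B0'.
Qed.

(** Induction on the dimension: conjugation by a Householder reflection whose
    first row is a unit eigenvector leaves a symmetric block of size one less. *)
Theorem real_spectral n (A : 'M[R]_n) : A^T = A ->
  exists (O : 'M[R]_n) (d : 'rV[R]_n), O *m O^T = 1%:M /\ O *m A *m O^T = diag_mx d.
Proof.
elim: n A => [|n IH] A symA.
  exists 1%:M, 0; split; apply/matrixP; by case.
have [a ea] := real_sym_eigenvalue symA.
have [u hu u0] := eigenvalueP ea.
pose c := (u *m u^T) 0 0.
have cu : u *m u^T = c%:M by rewrite -mx11_scalar.
have c0 : 0 < c.
  have cE : c = \sum_i u 0 i ^+ 2.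
    by rewrite /c mxE; apply: eq_bigr => i _; rewrite mxE expr2.
  rewrite lt0r; apply/andP; split; last by rewrite cE sumr_ge0// => i _; exact: sqr_ge0.
  apply/negP; rewrite cE => /eqP/psumr_eq0P h.
  case/negP: u0; apply/eqP/rowP => i; rewrite [RHS]mxE.
  have := h (fun i _ => sqr_ge0 _) i isT => /eqP; rewrite sqrf_eq0.
  by move/eqP.
pose v := (Num.sqrt c)^-1 *: u.
have v1 : v *m v^T = 1.
  rewrite /v linearZ/= -scalemxAl -scalemxAr cu scalerA.
  by rewrite scale_scalar_mx -invfM -expr2 sqr_sqrtr ?ltW// mulVf ?gt_eqF.
have vA : v *m A = a *: v by rewrite /v -scalemxAl hu !scalerA mulrC.
have [H [HH Hv]] := householder v1.
have HH' : H^T *m H = 1%:M by apply: mulmx1C.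
pose B : 'M[R]_(1 + n) := H *m A *m H^T.
have symB : B^T = B by rewrite /B !trmx_mul trmxK symA mulmxA.
have rB : row 0 B = a *: delta_mx 0 0.
  rewrite /B !row_mul Hv vA -scalemxAl; congr (_ *: _).
  have -> : v = delta_mx 0 0 *m H by rewrite -rowE.
  by rewrite -mulmxA HH mulmx1.
pose B' := drsubmx B.
have symB' : B'^T = B' by rewrite /B' -[in RHS]symB trmx_drsub.
have BE : B = block_mx a%:M 0 0 B'.
  exact: block_first_row.
have [Q1 [d1 [QQ1 Qd1]]] := IH _ symB'.
pose Q2 : 'M[R]_(1 + n) := block_mx 1%:M 0 0 Q1.
have QQ2 : Q2 *m Q2^T = 1%:M.
  rewrite /Q2 tr_block_mx mulmx_block !trmx0 trmx1 !mulmx0 !mul0mx !addr0 !add0r QQ1 mulmx1.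
  by rewrite [RHS]scalar_mx_block ?mul0mx.
have QB2 : Q2 *m B *m Q2^T = diag_mx (row_mx a%:M d1).
  rewrite BE /Q2 tr_block_mx !mulmx_block !trmx0 trmx1 !mulmx0 !mul0mx !addr0 !add0r.
  rewrite Qd1 !mulmx1 !mul1mx diag_mx_row; congr block_mx; rewrite ?mul0mx//.
  by apply/matrixP => i j; rewrite !mxE !ord1.
exists ((Q2 : 'M[R]_n.+1) *m H), (row_mx a%:M d1 : 'rV[R]_(1 + n)); split.
  by rewrite trmx_mul mulmxA -(mulmxA _ H) HH mulmx1.
by rewrite -QB2 /B trmx_mul !mulmxA.
Qed.

Lemma real_spectral_form n (A O : 'M[R]_n) (d : 'rV[R]_n) (v : 'cV[R]_n) :
  O *m O^T = 1%:M -> O *m A *m O^T = diag_mx d ->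
  (v^T *m A *m v) 0 0 = \sum_k d 0 k * (O *m v) k 0 ^+ 2 /\
  \sum_i v i 0 ^+ 2 = \sum_k (O *m v) k 0 ^+ 2.
Proof.
move=> OO OA; have OO' : O^T *m O = 1%:M by apply: mulmx1C.
split.
  have -> : v^T *m A *m v = (O *m v)^T *m diag_mx d *m (O *m v).
    by rewrite -OA trmx_mul !mulmxA -(mulmxA _ O^T O) OO' mulmx1
      -(mulmxA _ O^T O) OO' mulmx1.
  move: (O *m v) => y; rewrite mxE; apply: eq_bigr => k _.
  by rewrite mul_mx_diag !mxE; ring.
have : v^T *m v = (O *m v)^T *m (O *m v).
  by rewrite trmx_mul mulmxA -(mulmxA _ O^T O) OO' mulmx1.
move: (O *m v) => y /matrixP/(_ 0 0); rewrite !mxE => E.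
transitivity (\sum_j v^T 0 j * v j 0); first by apply: eq_bigr => j _; rewrite mxE expr2.
by rewrite E; apply: eq_bigr => j _; rewrite mxE expr2.
Qed.

Lemma real_spectral_eigenvalue n (A O : 'M[R]_n) (d : 'rV[R]_n) a :
  O *m O^T = 1%:M -> O *m A *m O^T = diag_mx d ->
  eigenvalue A a <-> exists k, a = d 0 k.
Proof.
move=> OO OA; have OO' : O^T *m O = 1%:M by apply: mulmx1C.
have OA' : O *m A = diag_mx d *m O by rewrite -OA -mulmxA OO' mulmx1.
split.
  move=> /eigenvalueP[u hu u0].
  have uO : (u *m O^T) *m diag_mx d = a *: (u *m O^T).
    by rewrite -OA !mulmxA -(mulmxA _ O^T O) OO' mulmx1 hu scalemxAl.
  have : u *m O^T != 0.
    apply/negP => /eqP h; case/negP: u0; apply/eqP.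
    by rewrite -[u]mulmx1 -OO' mulmxA h mul0mx.
  move/rV0Pn => [k yk]; exists k.
  have /matrixP/(_ 0 k) := uO; rewrite mul_mx_diag !mxE => E.
  move: yk; rewrite mxE => yk.
  by apply: (mulIf yk); rewrite -E mulrC.
move=> [k ->]; apply/eigenvalueP; exists (row k O).
  rewrite -row_mul OA' row_mul; apply/rowP => j; rewrite !mxE.
  rewrite (bigD1 k)//= big1 ?addr0 ?mxE ?eqxx// => l lk.
  by rewrite !mxE eq_sym (negbTE lk) mul0r.
apply/negP => /eqP h.
have /matrixP/(_ k k) := OO; rewrite !mxE eqxx/= => E.
have : (0 : R) = 1.
  rewrite -[RHS]E; apply/esym/big1 => j _.
  by have /rowP/(_ j) := h; rewrite !mxE => ->; rewrite mul0r.
by move/eqP; rewrite eq_sym oner_eq0.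
Qed.

(** In an orthonormal eigenbasis the quadratic form is a weighted sum of squares
    whose weights are the eigenvalues. The infimum is positive because it is
    attained, at an index [k0], and the form is positive on the corresponding
    eigenvector. *)
Lemma posdef_rayleigh n (A : 'M[R]_n) : (0 < n)%N -> posdefmx A ->
  0 < lambda_min A /\
  forall v : 'cV[R]_n, lambda_min A * \sum_i v i 0 ^+ 2 <= (v^T *m A *m v) 0 0
    <= lambda_max A * \sum_i v i 0 ^+ 2.
Proof.
move=> n0 [symA posA].
have [Q [d [QQ QA]]] := real_spectral symA.
have spec a := real_spectral_eigenvalue a QQ QA.
have QQ' : Q^T *m Q = 1%:M by apply: mulmx1C.
have [k0 _ k0min] := @arg_minP _ _ _ (Ordinal n0) xpredT (fun k => d 0 k) isT.
have lb : lbound [set a | eigenvalue A a] (d 0 k0).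
  by move=> a /= /spec[k ->]; exact: k0min.
have ub : has_ubound [set a | eigenvalue A a].
  exists (\sum_k `|d 0 k|) => a /= /spec[k ->].
  by rewrite (le_trans (ler_norm _))// (bigD1 k)//= lerDl sumr_ge0.
have ne : [set a | eigenvalue A a] !=set0 by exists (d 0 k0) => /=; apply/spec; exists k0.
split.
  apply: (@lt_le_trans _ _ (d 0 k0)); last exact: lb_le_inf.
  pose v : 'cV[R]_n := Q^T *m delta_mx k0 0.
  have v0 : v != 0.
    apply/negP => /eqP h.
    have : Q *m v = 0 by rewrite h mulmx0.
    rewrite /v mulmxA QQ mul1mx => /matrixP/(_ k0 0).
    by rewrite !mxE !eqxx => /eqP; rewrite oner_eq0.
  have := posA v v0; have [-> _] := real_spectral_form v QQ QA.
  rewrite /v mulmxA QQ mul1mx (bigD1 k0)//= big1 ?addr0.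
    by rewrite mxE !eqxx expr1n mulr1.
  by move=> l lk; rewrite mxE (negbTE lk) expr0n mulr0.
move=> v; have [-> ->] := real_spectral_form v QQ QA.
rewrite !mulr_sumr; apply/andP; split; apply: ler_sum => k _; rewrite ler_wpM2r ?sqr_ge0//.
  by apply: ge_inf; [exists (d 0 k0)|apply/spec; exists k].
by apply: ub_le_sup => //; apply/spec; exists k.
Qed.
End spectral.

(** * Concentration of Gaussian quadratic forms *)

Section gaussian_quadratic.
Context {R : realType} d (Omega : measurableType d) (P : probability Omega R).
Variables (n : nat) (U : 'I_n -> Omega -> R) (Q : 'M[R]_n) (K : R).
Hypothesis symQ : Q^T = Q.
Hypothesis normalU : forall a : 'I_n -> R,
  centered_normal P (fun w => \sum_i a i * U i w) (\sum_i \sum_j a i * a j * Q i j).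
Hypothesis K0 : 0 <= K.
Hypothesis rowK : forall i, \sum_j `|Q i j| <= K.

(** Schur's test, from 2 |v_i v_j| <= v_i^2 + v_j^2. *)
Lemma quadratic_row_bound (v : 'cV[R]_n) :
  (v^T *m Q *m v) 0 0 <= K * \sum_i v i 0 ^+ 2.
Proof.
have -> : (v^T *m Q *m v) 0 0 = \sum_j \sum_i v i 0 * Q i j * v j 0.
  rewrite mxE; apply: eq_bigr => j _; rewrite mxE mulr_suml.
  by apply: eq_bigr => i _; rewrite mxE.
have symE i j : Q j i = Q i j by rewrite -[in LHS]symQ mxE.
apply: (@le_trans _ _ (\sum_j \sum_i `|Q i j| * (v i 0 ^+ 2 + v j 0 ^+ 2) / 2)).
  apply: ler_sum => j _; apply: ler_sum => i _.
  apply: (@le_trans _ _ (`|Q i j| * (`|v i 0| * `|v j 0|))).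
    by rewrite (le_trans (ler_norm _))// !normrM mulrCA mulrA mulrC mulrA mulrC.
  rewrite -mulrA ler_wpM2l// -(real_normK (num_real (v i 0))) -(real_normK (num_real (v j 0))).
  by have := sqr_ge0 (`|v i 0| - `|v j 0|); lra.
have half : \sum_j \sum_i `|Q i j| * v j 0 ^+ 2 <= K * \sum_i v i 0 ^+ 2.
  rewrite mulr_sumr; apply: ler_sum => j _; rewrite -mulr_suml ler_wpM2r ?sqr_ge0//.
  by apply: le_trans (rowK j); apply: ler_sum => i _; rewrite symE.
have half2 : \sum_j \sum_i `|Q i j| * v i 0 ^+ 2 <= K * \sum_i v i 0 ^+ 2.
  apply: le_trans half; rewrite exchange_big/=.
  by apply: ler_sum => i _; apply: ler_sum => j _; rewrite symE.
have -> : \sum_j \sum_i `|Q i j| * (v i 0 ^+ 2 + v j 0 ^+ 2) / 2 =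
   2^-1 * (\sum_j \sum_i `|Q i j| * v i 0 ^+ 2 + \sum_j \sum_i `|Q i j| * v j 0 ^+ 2).
  rewrite -big_split/= mulr_sumr; apply: eq_bigr => j _.
  rewrite -big_split/= mulr_sumr; apply: eq_bigr => i _.
  by field.
lra.
Qed.

Let mU i : measurable_fun setT (U i).
Proof.
have [+ _ _ _] := normalU (fun j => (j == i)%:R).
congr measurable_fun; apply/funext => w.
by rewrite (bigD1 i)//= eqxx mul1r big1 ?addr0// => j /negbTE ->; rewrite mul0r.
Qed.

(** The coordinates of [U] in an orthonormal eigenbasis of [Q]. They are indexed
    by [nat], with zeros from [n] on, since the Laplace transform is computed by
    induction on the number of variables. *)
Let principal_components : exists (W : nat -> Omega -> R) (lam : nat -> R),
  [/\ forall k, measurable_fun setT (W k),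
      forall k, 0 <= lam k <= K,
      forall w, \sum_(k < n) W k w ^+ 2 = \sum_i U i w ^+ 2,
      \sum_(k < n) lam k = \tr Q &
      forall a : nat -> R, centered_normal P (fun w => \sum_(k < n) a k * W k w)
        (\sum_(k < n) a k ^+ 2 * lam k)].
Proof.
have [V [l [VV VQ]]] := real_spectral symQ.
have VV' : V^T *m V = 1%:M by apply: mulmx1C.
pose row k j : R := if insub k is Some i then V i j else 0.
have rowE (k : 'I_n) j : row k j = V k j by rewrite /row valK.
pose lam k : R := if insub k is Some i then l 0 i else 0.
have lamE (k : 'I_n) : lam k = l 0 k by rewrite /lam valK.
pose W k w := \sum_j row k j * U j w.
have var (a : 'I_n -> R) : \sum_i \sum_j (\sum_k a k * V k i) * (\sum_k a k * V k j) * Q i j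
   = \sum_k a k ^+ 2 * l 0 k.
  pose r : 'rV[R]_n := \row_k a k.
  have -> : \sum_i \sum_j (\sum_k a k * V k i) * (\sum_k a k * V k j) * Q i j =
      ((r *m V) *m Q *m (r *m V)^T) 0 0.
    rewrite mxE exchange_big/=; apply: eq_bigr => j _.
    rewrite mxE mulr_suml; apply: eq_bigr => i _.
    rewrite !mxE [LHS]mulrAC; congr (_ * _ * _);
      by apply: eq_bigr => k _; rewrite !mxE.
  rewrite trmx_mul !mulmxA -(mulmxA r) -(mulmxA r) VQ mxE.
  by apply: eq_bigr => k _; rewrite mul_mx_diag !mxE; ring.
have W_normal (a : nat -> R) : centered_normal P (fun w => \sum_(k < n) a k * W k w)
        (\sum_(k < n) a k ^+ 2 * lam k).
  have := normalU (fun j => \sum_(k < n) a k * V k j).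
  rewrite var; congr centered_normal.
    apply/funext => w; rewrite /W.
    under [RHS]eq_bigr do rewrite mulr_sumr.
    rewrite exchange_big/=; apply: eq_bigr => j _.
    by rewrite mulr_suml; apply: eq_bigr => k _; rewrite rowE mulrA.
  by apply: eq_bigr => k _; rewrite lamE.
exists W, lam; split => //.
- by move=> k; apply: measurable_sum => j; exact: measurable_funM.
- move=> k; rewrite /lam; case: insubP => [i _ ki|kn]; last by rewrite lexx.
  apply/andP; split.
    have [_ + _ _] := W_normal (fun j => (j == k)%:R).
    rewrite (bigD1 i)//= ki eqxx expr1n mul1r big1 ?addr0; last first.
      move=> j ji; rewrite -ki; have -> : (nat_of_ord j == i) = false by exact: negbTE.
      by rewrite expr0n mul0r.
    by rewrite /lam -ki valK.
  have [h1 h2] := real_spectral_form (V^T *m delta_mx i 0) VV VQ.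
  have := quadratic_row_bound (V^T *m delta_mx i 0).
  rewrite h1 h2 mulmxA VV mul1mx.
  have dE j : (delta_mx i 0 : 'cV[R]_n) j 0 ^+ 2 = (j == i)%:R.
    by rewrite mxE eqxx andbT; case: eqP => _; rewrite ?expr1n ?expr0n.
  under eq_bigr do rewrite dE.
  under [X in _ <= _ * X]eq_bigr do rewrite dE.
  rewrite (bigD1 i)//= big1 => [|j /negbTE ->]; last by rewrite mulr0.
  rewrite (bigD1 i)//= big1 => [|j /negbTE ->]; last by [].
  by rewrite eqxx !addr0 !mulr1.
- move=> w; pose u : 'cV[R]_n := \col_i U i w.
  have [_] := real_spectral_form u VV VQ.
  have -> : \sum_i u i 0 ^+ 2 = \sum_i U i w ^+ 2 by apply: eq_bigr => i _; rewrite mxE.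
  move=> ->; apply: eq_bigr => k _; congr (_ ^+ 2).
  by rewrite mxE; apply: eq_bigr => j _; rewrite rowE mxE.
- have -> : \tr Q = \tr (diag_mx l).
    by rewrite -VQ mxtrace_mulC mulmxA VV' mul1mx.
  by rewrite mxtrace_diag; apply: eq_bigr => k _; rewrite lamE.
Qed.

Lemma inv_sqrt_le_exp (x y : R) : 0 < x -> 1 <= x * expR y ->
  (Num.sqrt x)^-1 <= expR (y / 2).
Proof.
move=> x0 h.
have sx : 0 < Num.sqrt x by rewrite sqrtr_gt0.
rewrite -[X in X <= _]mul1r ler_pdivrMr//.
rewrite -(@ler_pXn2r _ 2)// ?nnegrE ?mulr_ge0 ?expR_ge0 ?(ltW sx)//.
rewrite expr1n exprMn sqr_sqrtr ?(ltW x0)// -expRM_natl.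
have -> : 2 * (y / 2) = y by field.
by rewrite mulrC.
Qed.

(** For x >= 0, (1 + x)^(-1/2) <= exp ((x^2 - x) / 2), because
    (1 + x) (1 - x + x^2) = 1 + x^3 >= 1. This is used with x = 2 s lam_k; the
    linear terms add up to the trace and the quadratic ones are bounded by
    [K]. *)
Lemma quadratic_laplace_neg s : 0 <= s ->
  \int[P]_w expR (- (s * \sum_i U i w ^+ 2)) <=
  expR (- (s * \tr Q) + 2 * s ^+ 2 * K ^+ 2 * n%:R).
Proof.
move=> s0; have [W [lam [mW lamK WU ltr Wn]]] := principal_components.
have lam0 k : 0 <= lam k by have /andP[] := lamK k.
have h : \int[P]_w (1 * expR (- (s * \sum_(k < n) W k w ^+ 2))) =
    1 * \prod_(k < n) (Num.sqrt (1 + 2 * (s * lam k)))^-1.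
  apply: laplace_squares_neg => //.
    by exists 1 => w; rewrite normr1.
  move=> a; have [_ _ _ cf] := Wn a; have := cf 1 0.
  rewrite cos0 expr1n !mul1r mulr_suml => <-.
  by apply: eq_Rintegral => w _; rewrite !mul1r addr0.
have -> : \int[P]_w expR (- (s * \sum_i U i w ^+ 2)) =
    \int[P]_w (1 * expR (- (s * \sum_(k < n) W k w ^+ 2))).
  by apply: eq_Rintegral => w _; rewrite mul1r WU.
rewrite h mul1r.
apply: (@le_trans _ _ (\prod_(k < n) expR (- (s * lam k) + 2 * s ^+ 2 * lam k ^+ 2))).
  apply: ler_prod => k _; rewrite invr_ge0 sqrtr_ge0/=.
  pose x := 2 * (s * lam k).
  have x0 : 0 <= x by rewrite !mulr_ge0.
  have -> : - (s * lam k) + 2 * s ^+ 2 * lam k ^+ 2 = (x ^+ 2 - x) / 2.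
    by rewrite /x; field.
  apply: inv_sqrt_le_exp; first by rewrite -/x; lra.
  rewrite -/x; have := expR_ge1Dx (x ^+ 2 - x) => e1.
  apply: (@le_trans _ _ ((1 + x) * (1 + (x ^+ 2 - x)))).
    have : 0 <= x ^+ 3 by rewrite exprn_ge0.
    lra.
  by rewrite ler_wpM2l// addr_ge0.
rewrite -expR_sum ler_expR big_split/= sumrN -mulr_sumr ltr lerD2l.
rewrite -mulr_sumr -[leRHS]mulrA ler_wpM2l ?mulr_ge0 ?sqr_ge0//.
rewrite mulr_natr -[n in _ *+ n]card_ord -sumr_const; apply: ler_sum => k _.
by have /andP[? ?] := lamK k; rewrite lerXn2r ?nnegrE.
Qed.

(** For 0 <= x <= 1/2, (1 - x)^(-1/2) <= exp ((x + 2 x^2) / 2), because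
    (1 - x) (1 + x + 2 x^2) = 1 + x^2 (1 - 2 x) >= 1. *)
Lemma quadratic_laplace_pos s : 0 <= s -> 4 * (s * K) <= 1 ->
  (\int[P]_w (expR (s * \sum_i U i w ^+ 2))%:E <=
  (expR (s * \tr Q + 4 * s ^+ 2 * K ^+ 2 * n%:R))%:E)%E.
Proof.
move=> s0 sK; have [W [lam [mW lamK WU ltr Wn]]] := principal_components.
have lam0 k : 0 <= lam k by have /andP[] := lamK k.
have slam k : 4 * (s * lam k) <= 1.
  apply: le_trans sK; rewrite ler_wpM2l// ler_wpM2l//.
  by have /andP[] := lamK k.
have h : (\int[P]_w (1 * expR (s * \sum_(k < n) W k w ^+ 2))%:E =
    (1 * \prod_(k < n) (Num.sqrt (1 - 2 * (s * lam k)))^-1)%:E)%E.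
  apply: laplace_squares_pos => //.
    by move=> k; have := slam k; lra.
  move=> a; have [_ _ mgf _] := Wn a; have := mgf 1.
  rewrite expr1n !mul1r mulr_suml => <-.
  by apply: eq_integral => w _; rewrite !mul1r.
have -> : (\int[P]_w (expR (s * \sum_i U i w ^+ 2))%:E =
    \int[P]_w (1 * expR (s * \sum_(k < n) W k w ^+ 2))%:E)%E.
  by apply: eq_integral => w _; rewrite mul1r WU.
rewrite h mul1r lee_fin.
apply: (@le_trans _ _ (\prod_(k < n) expR (s * lam k + 4 * s ^+ 2 * lam k ^+ 2))).
  apply: ler_prod => k _; rewrite invr_ge0 sqrtr_ge0/=.
  pose x := 2 * (s * lam k).
  have x0 : 0 <= x by rewrite !mulr_ge0.
  have x1 : x <= 2^-1 by have := slam k; rewrite /x; lra.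
  have -> : s * lam k + 4 * s ^+ 2 * lam k ^+ 2 = (x + 2 * x ^+ 2) / 2.
    by rewrite /x; field.
  apply: inv_sqrt_le_exp; first by rewrite -/x; lra.
  rewrite -/x; have := expR_ge1Dx (x + 2 * x ^+ 2) => e1.
  apply: (@le_trans _ _ ((1 - x) * (1 + (x + 2 * x ^+ 2)))).
    have : 0 <= x ^+ 2 * (1 - 2 * x) by rewrite mulr_ge0 ?sqr_ge0//; lra.
    lra.
  by rewrite ler_wpM2l//; lra.
rewrite -expR_sum ler_expR big_split/= -mulr_sumr ltr lerD2l.
rewrite -mulr_sumr -[leRHS]mulrA ler_wpM2l ?mulr_ge0 ?sqr_ge0//.
rewrite mulr_natr -[n in _ *+ n]card_ord -sumr_const; apply: ler_sum => k _.
by have /andP[? ?] := lamK k; rewrite lerXn2r ?nnegrE.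
Qed.

Lemma exp_markov (f : Omega -> R) (c : R) : measurable_fun setT f ->
  (P [set w | c <= f w]%R <= (expR (- c))%:E * \int[P]_w (expR (f w))%:E)%E.
Proof.
move=> mf.
have mA : measurable [set w | c <= f w] by exact: measurable_set_ge.
rewrite -ge0_integralZl//; last first.
  by apply/measurable_EFinP; exact: measurableT_comp.
rewrite -[X in P X]setIT -integral_indic//; apply: ge0_le_integral => //.
- by apply/measurable_EFinP; exact: measurable_indic.
- apply/measurable_EFinP; apply: measurable_funM => //.
  exact: measurableT_comp.
move=> w _; rewrite -EFinM lee_fin -expRD indicE.
case: (boolP (w \in _)) => [|_]; last exact: expR_ge0.
rewrite inE/= => cf; rewrite -[1]expR0 ler_expR; lra.
Qed.

Let msum : measurable_fun setT (fun w => \sum_i U i w ^+ 2).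
Proof. by apply: measurable_sum => i; exact: measurable_funX. Qed.

(** Chernoff's bound with the parameter s = dl / (8 K^2), for which the linear
    gain s n dl dominates the quadratic term of [quadratic_laplace_neg]. *)
Lemma quadratic_lower_tail dl : 0 < K -> 0 < dl ->
  (P [set w | \sum_i U i w ^+ 2 <= \tr Q - n%:R * dl]%R <=
   (expR (- (n%:R * dl ^+ 2 / (16 * K ^+ 2))))%:E)%E.
Proof.
move=> Kgt0 dl0; pose s := dl / (8 * K ^+ 2).
have s0 : 0 <= s by rewrite divr_ge0 ?mulr_ge0 ?sqr_ge0// ltW.
have K2 : K != 0 by rewrite gt_eqF.
pose f w := - (s * \sum_i U i w ^+ 2).
have mf : measurable_fun setT f.
  by apply: measurableT_comp => //; exact: measurable_funM.
pose c := - (s * (\tr Q - n%:R * dl)).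
apply: (@le_trans _ _ (P [set w | c <= f w]%R)).
  apply: le_measure; rewrite ?inE.
  - exact: measurable_set_le.
  - exact: measurable_set_ge.
  - by move=> w /= h; rewrite /c /f lerN2 ler_wpM2l.
apply: le_trans (exp_markov c mf) _.
have iE : P.-integrable setT (EFin \o (fun w => expR (f w))).
  apply: (@bounded_integrable _ _ _ _ _ 1) => [|w]; first exact: measurableT_comp.
  rewrite ger0_norm ?expR_ge0// -expR0 ler_expR /f oppr_le0 mulr_ge0// sumr_ge0//.
  by move=> i _; exact: sqr_ge0.
rewrite (EFin_Rintegral iE) -EFinM lee_fin.
apply: (@le_trans _ _ (expR (- c) * expR (- (s * \tr Q) + 2 * s ^+ 2 * K ^+ 2 * n%:R))).
  by rewrite ler_wpM2l ?expR_ge0//; exact: quadratic_laplace_neg.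
rewrite -expRD ler_expR /c.
have -> : - - (s * (\tr Q - n%:R * dl)) + (- (s * \tr Q) + 2 * s ^+ 2 * K ^+ 2 * n%:R) =
   - (3 / 2 * (n%:R * dl ^+ 2 / (16 * K ^+ 2))).
  by rewrite /s; field.
have : 0 <= n%:R * dl ^+ 2 / (16 * K ^+ 2).
  by apply: divr_ge0; apply: mulr_ge0; rewrite ?sqr_ge0.
lra.
Qed.

(** The same parameter is the optimal one for the bound of
    [quadratic_laplace_pos], and [dl <= 2 * K] keeps it in the range where that
    bound holds. *)
Lemma quadratic_upper_tail dl : 0 < K -> 0 < dl -> dl <= 2 * K ->
  (P [set w | \tr Q + n%:R * dl <= \sum_i U i w ^+ 2]%R <=
   (expR (- (n%:R * dl ^+ 2 / (16 * K ^+ 2))))%:E)%E.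
Proof.
move=> Kgt0 dl0 dlK; pose s := dl / (8 * K ^+ 2).
have s0 : 0 <= s by rewrite divr_ge0 ?mulr_ge0 ?sqr_ge0// ltW.
have K2 : K != 0 by rewrite gt_eqF.
have sK : 4 * (s * K) <= 1.
  have -> : 4 * (s * K) = dl / (2 * K) by rewrite /s; field.
  by rewrite ler_pdivrMr ?mulr_gt0// mul1r.
pose f w := s * \sum_i U i w ^+ 2.
have mf : measurable_fun setT f by exact: measurable_funM.
pose c := s * (\tr Q + n%:R * dl).
apply: (@le_trans _ _ (P [set w | c <= f w]%R)).
  apply: le_measure; rewrite ?inE.
  - exact: measurable_set_ge.
  - exact: measurable_set_ge.
  - by move=> w /= h; rewrite /c /f ler_wpM2l.
apply: le_trans (exp_markov c mf) _.
apply: (@le_trans _ _ ((expR (- c))%:E * (expR (s * \tr Q + 4 * s ^+ 2 * K ^+ 2 * n%:R))%:E)%E).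
  by rewrite lee_wpmul2l ?lee_fin ?expR_ge0//; exact: quadratic_laplace_pos.
rewrite -EFinM lee_fin -expRD ler_expR /c.
have -> : - (s * (\tr Q + n%:R * dl)) + (s * \tr Q + 4 * s ^+ 2 * K ^+ 2 * n%:R) =
   - (n%:R * dl ^+ 2 / (16 * K ^+ 2)) by rewrite /s; field.
by [].
Qed.
End gaussian_quadratic.

(** * Mixing controls Gaussian correlations *)

Section covariance_inequality.
Context {R : realType} d (Omega : measurableType d) (P : probability Omega R).

Lemma layer_count (y : R) m : 0 <= y <= m%:R ->
  y <= \sum_(k < m) (k%:R < y)%R%:R <= y + 1.
Proof.
elim: m => [|m IH] /andP[y0 ym].
  by rewrite big_ord0; apply/andP; split; lra.
rewrite big_ord_recr/=; have [my|ym'] := ltP m%:R y; last first.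
  by rewrite addr0; apply: IH; rewrite y0.
rewrite (eq_bigr (fun=> 1)) => [|k _]; last first.
  by rewrite (_ : _ < _ = true)//; apply: le_lt_trans my; rewrite ler_nat ltnW.
rewrite sumr_const card_ord.
by move: ym; rewrite -natr1 (_ : true%:R = 1)// => ym; apply/andP; split; lra.
Qed.

(** The hypothesis on indicators of sets in [F] extends to [f] by the layer cake
    formula: up to 1/N, [f] equals - 1 plus N^-1 times a sum of 2N indicators of
    sets {f > c}, and the constant contributes nothing since E h = 0. *)
Lemma layer_bound (F : set (set Omega)) (f h : Omega -> R) (a : R) :
  (forall A, F A -> measurable A) ->
  measurable_fun setT f -> (forall w, `|f w| <= 1) ->
  (forall c, F [set w | c < f w]) ->
  measurable_fun setT h -> (forall w, `|h w| <= 2) -> \int[P]_w h w = 0 ->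
  (forall A, F A -> `|\int[P]_w (\1_A w * h w)| <= a) ->
  `|\int[P]_w (f w * h w)| <= 2 * a.
Proof.
move=> Fm mf f1 Ff mh h2 Eh hA.
have ih : P.-integrable setT (EFin \o h) by exact: (bounded_integrable P mh h2).
suff key n : `|\int[P]_w (f w * h w)| <= 2 * a + 2 * n.+1%:R^-1.
  rewrite leNgt; apply/negP => lt.
  have e0 : 0 < `|\int[P]_w (f w * h w)| - 2 * a by rewrite subr_gt0.
  have [n hn] := ltr_add_invr (x := (`|\int[P]_w (f w * h w)| - 2 * a) / 2) (y := 0) (divr_gt0 e0 (ltr0Sn _ 1)).
  by have := key n; move: hn; rewrite add0r; move: (n.+1%:R^-1) => z; lra.
set N : R := n.+1%:R; have N0 : 0 < N by rewrite ltr0n.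
pose A (k : nat) := [set w | k%:R / N - 1 < f w].
have mA k : measurable (A k) by apply: Fm; exact: Ff.
pose g w := N^-1 * \sum_(k < 2 * n.+1) \1_(A k) w - 1.
have mi k : measurable_fun setT (\1_(A k) : Omega -> R) by exact: measurable_indic.
have mg : measurable_fun setT g.
  apply: measurable_funB => //; apply: measurable_funM => //.
  exact: measurable_sum.
have fg w : `|f w - g w| <= N^-1.
  have /andP[fm fM] : -1 <= f w <= 1 by have := f1 w; rewrite ler_norml.
  have y0 : 0 <= N * (f w + 1) <= (2 * n.+1)%:R.
    rewrite mulr_ge0 ?(ltW N0)//=; last lra.
    by rewrite natrM mulrC ler_wpM2r ?ler0n//; lra.
  have /andP[] := layer_count y0.
  have -> : \sum_(k < 2 * n.+1) (k%:R < N * (f w + 1))%R%:R = \sum_(k < 2 * n.+1) \1_(A k) w :> R.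
    apply: eq_bigr => k _; rewrite indicE /A; congr (nat_of_bool _)%:R.
    apply/idP/idP; rewrite inE/= ltrBlDr ltr_pdivrMr// mulrC//.
  rewrite /g; set S := \sum_(k < _) _ => S1 S2.
  have -> : f w - (N^-1 * S - 1) = N^-1 * (N * (f w + 1) - S) by field; rewrite gt_eqF.
  rewrite normrM gtr0_norm ?invr_gt0// -[leRHS]mulr1 ler_wpM2l ?invr_ge0 ?(ltW N0)//.
  by rewrite ler_norml; apply/andP; split; lra.
have iA k : P.-integrable setT (EFin \o (fun w => \1_(A k) w * h w)).
  apply: (@bounded_integrable _ _ _ _ _ 2) => [|w]; first exact: measurable_funM.
  by rewrite indicE normrM; case: (_ \in _); rewrite ?normr1 ?normr0 ?mul1r ?mul0r.
have igh : P.-integrable setT (EFin \o (fun w => g w * h w)).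
  apply: (@bounded_integrable _ _ _ _ _ ((1 + N^-1) * 2)) => [|w]; first exact: measurable_funM.
  rewrite normrM ler_pM//.
  have -> : g w = f w - (f w - g w) by ring.
  by rewrite (le_trans (ler_normB _ _))// lerD.
have ifh : P.-integrable setT (EFin \o (fun w => f w * h w)).
  apply: (@bounded_integrable _ _ _ _ _ (1 * 2)) => [|w]; first exact: measurable_funM.
  by rewrite normrM ler_pM.
have Egh : `|\int[P]_w (g w * h w)| <= 2 * a.
  have -> : \int[P]_w (g w * h w) = N^-1 * \sum_(k < 2 * n.+1) \int[P]_w (\1_(A k) w * h w).
    have [I1 I2] := Rintegral_finsum (fun k : 'I_(2 * n.+1) => iA k).
    rewrite -I2 -RintegralZl// -[LHS]addr0.
    have := RintegralD measurableT igh ih; rewrite Eh => <-.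
    by apply: eq_Rintegral => w _; rewrite -mulr_suml /g; ring.
  rewrite normrM gtr0_norm ?invr_gt0// mulrC ler_pdivrMr//.
  rewrite (le_trans (ler_norm_sum _ _ _))//.
  apply: (@le_trans _ _ (\sum_(k < 2 * n.+1) a)).
    by apply: ler_sum => k _; apply: hA; exact: Ff.
  by rewrite sumr_const card_ord -[a *+ _]mulr_natr natrM mulrA (mulrC a).
have -> : \int[P]_w (f w * h w) = \int[P]_w (g w * h w) + \int[P]_w ((f w - g w) * h w).
  rewrite -RintegralD//.
    by apply: eq_Rintegral => w _; ring.
  apply: (@bounded_integrable _ _ _ _ _ (N^-1 * 2)) => [|w].
    by apply: measurable_funM => //; exact: measurable_funB.
  by rewrite normrM ler_pM.
have mfgh : measurable_fun setT (fun w => (f w - g w) * h w).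
  by apply: measurable_funM => //; exact: measurable_funB.
have ifgh : P.-integrable setT (EFin \o (fun w => (f w - g w) * h w)).
  apply: (@bounded_integrable _ _ _ _ _ (N^-1 * 2)) => // w.
  by rewrite normrM ler_pM.
rewrite (le_trans (ler_normD _ _))// lerD//.
rewrite (le_trans (le_normr_Rintegral _ ifgh))//.
rewrite -[leRHS](Rintegral_prob_cst P); apply: le_Rintegral => //.
- by apply: integrable_norm.
- exact: integrable_cst_EFin.
- by move=> w _; rewrite normrM mulrC ler_pM.
Qed.

(** [layer_bound] applied twice: first to [f] against the centred indicator of a
    set in [G], then to [g] against the centred variable [f]. *)
Lemma covariance_mixing (F G : set (set Omega)) (f g : Omega -> R) (a : R) :
  (forall A, F A -> measurable A) -> (forall A, G A -> measurable A) ->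
  (forall A B, F A -> G B -> `|fine (P (A `&` B)) - fine (P A) * fine (P B)| <= a) ->
  measurable_fun setT f -> (forall w, `|f w| <= 1) -> (forall c, F [set w | c < f w]) ->
  measurable_fun setT g -> (forall w, `|g w| <= 1) -> (forall c, G [set w | c < g w]) ->
  `|\int[P]_w (f w * g w) - \int[P]_w f w * \int[P]_w g w| <= 4 * a.
Proof.
move=> Fm Gm FG mf f1 Ff mg g1 Gg.
have If : P.-integrable setT (EFin \o f) by exact: (bounded_integrable P mf f1).
have Ig : P.-integrable setT (EFin \o g) by exact: (bounded_integrable P mg g1).
have Ifg : P.-integrable setT (EFin \o (fun w => f w * g w)).
  apply: (@bounded_integrable _ _ _ _ _ (1 * 1)) => [|w]; first exact: measurable_funM.
  by rewrite normrM ler_pM.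
have P01 A : measurable A -> 0 <= fine (P A) <= 1.
  by move=> mA; rewrite fine_ge0//= -lee_fin fineK ?fin_num_measure// probability_le1.
have I1 A : measurable A -> P.-integrable setT (EFin \o (\1_A : Omega -> R)).
  move=> mA; apply: (@bounded_integrable _ _ _ _ _ 1) => [|w]; first exact: measurable_indic.
  by rewrite indicE; case: (_ \in _); rewrite ?normr1 ?normr0.
have E1 A : measurable A -> \int[P]_w (\1_A w) = fine (P A).
  by move=> mA; rewrite /Rintegral integral_indic// setIT.
have Ef1 : `|\int[P]_w f w| <= 1.
  rewrite (le_trans (le_normr_Rintegral _ If))// -[leRHS](Rintegral_prob_cst P).
  by apply: le_Rintegral => //; [exact: integrable_norm|exact: integrable_cst_EFin].
have step1 B : G B -> `|\int[P]_w (f w * (\1_B w - fine (P B)))| <= 2 * a.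
  move=> GB; have mB := Gm _ GB; have /andP[pB0 pB1] := P01 _ mB.
  apply: (layer_bound Fm mf f1 Ff).
  - by apply: measurable_funB => //; exact: measurable_indic.
  - move=> w; rewrite indicE ler_norml; case: (_ \in _) => /=; rewrite ?mulr1n ?mulr0n; apply/andP; split; lra.
  - rewrite RintegralB//; [|exact: I1|exact: integrable_cst_EFin].
    by rewrite Rintegral_prob_cst E1// subrr.
  - move=> A FA; have mA := Fm _ FA.
    have -> : \int[P]_w (\1_A w * (\1_B w - fine (P B))) =
        fine (P (A `&` B)) - fine (P A) * fine (P B).
      rewrite -(E1 (A `&` B)); last exact: measurableI.
      rewrite -(E1 A)// -RintegralZr//; last exact: I1.
      rewrite -RintegralB//.
      + by apply: eq_Rintegral => w _; rewrite indicI/= mulrBr.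
      + by apply: I1; exact: measurableI.
      + rewrite /comp; under eq_fun do rewrite mulrC.
        by apply: integrableZ_EFin; exact: I1.
    exact: FG.
have -> : \int[P]_w (f w * g w) - \int[P]_w f w * \int[P]_w g w =
    \int[P]_w (g w * (f w - \int[P]_z f z)).
  rewrite mulrC -RintegralZr// -RintegralB//.
    by apply: eq_Rintegral => w _; ring.
  by rewrite /comp; under eq_fun do rewrite mulrC; exact: integrableZ_EFin.
have -> : 4 * a = 2 * (2 * a) by ring.
apply: (layer_bound Gm mg g1 Gg).
- exact: measurable_funB.
- by move=> w; rewrite (le_trans (ler_normB _ _))//; have := f1 w; lra.
- by rewrite RintegralB//; [rewrite Rintegral_prob_cst subrr|exact: integrable_cst_EFin].
- move=> B GB; have mB := Gm _ GB; have := step1 B GB.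
  congr (`|_| <= _).
  have IfB : P.-integrable setT (EFin \o (fun w => f w * \1_B w)).
    apply: (@bounded_integrable _ _ _ _ _ (1 * 1)) => [|w].
      by apply: measurable_funM => //; exact: measurable_indic.
    by rewrite normrM ler_pM// indicE; case: (_ \in _); rewrite ?normr1 ?normr0.
  transitivity (\int[P]_w (f w * \1_B w) - \int[P]_w f w * fine (P B)).
    rewrite -RintegralZr// -RintegralB//.
      by apply: eq_Rintegral => w _; ring.
    by rewrite /comp; under eq_fun do rewrite mulrC; exact: integrableZ_EFin.
  rewrite -E1// -RintegralZl//; last exact: I1.
  rewrite -RintegralB//.
    by apply: eq_Rintegral => w _; ring.
  by apply: integrableZ_EFin; exact: I1.
Qed.
End covariance_inequality.

Section gaussian_correlation.
Context {R : realType} d (Omega : measurableType d) (P : probability Omega R).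

Lemma abs_sinh_ge (x : R) : 2 * `|x| <= `|expR x - expR (- x)|.
Proof.
have [x0|x0] := leP 0 x.
  by rewrite (ger0_norm x0) (le_trans (sinh_ge x0)) ?ler_norm.
have := @sinh_ge R (- x); rewrite opprK oppr_ge0 => /(_ (ltW x0)) h.
by rewrite (ltr0_norm x0) distrC (le_trans h)// ler_norm.
Qed.

(** After rescaling to variance 1, put r for the correlation. The product formula
    for sines and the normality of U - V and U + V give
    E[sin U sin V] = (exp (- (1 - r)) - exp (- (1 + r))) / 2, whose absolute
    value is at least |r| / e. The variables sin U and sin V are bounded and
    centred, so [covariance_mixing] applies to them. *)
Lemma gaussian_correlation_mixing (F G : set (set Omega)) (U V : Omega -> R) (v r a : R) :
  (forall A, F A -> measurable A) -> (forall A, G A -> measurable A) ->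
  (forall A B, F A -> G B -> `|fine (P (A `&` B)) - fine (P A) * fine (P B)| <= a) ->
  0 < v ->
  (forall x y, centered_normal P (fun w => x * U w + y * V w)
     (x ^+ 2 * v + 2 * x * y * r + y ^+ 2 * v)) ->
  (forall t c, F [set w | c < sin (t * U w)]) ->
  (forall t c, G [set w | c < sin (t * V w)]) ->
  `|r| <= 4 * expR 1 * a * v.
Proof.
move=> Fm Gm FG v0 N FU GV.
pose t := (Num.sqrt v)^-1.
have sv : 0 < Num.sqrt v by rewrite sqrtr_gt0.
have t2 : t ^+ 2 = v^-1 by rewrite exprVn sqr_sqrtr// ltW.
have mU : measurable_fun setT U.
  have [+ _ _ _] := N 1 0; congr measurable_fun; apply/funext => w; ring.
have mV : measurable_fun setT V.
  have [+ _ _ _] := N 0 1; congr measurable_fun; apply/funext => w; ring.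
have msin (L : Omega -> R) : measurable_fun setT L -> measurable_fun setT (fun w => sin (t * L w)).
  move=> mL; apply: measurableT_comp; first exact: measurable_sin.
  exact: measurable_funM.
have Esin : \int[P]_w sin (t * U w) = 0.
  have [_ _ _ cf] := N 1 0; have := cf t (- (pi / 2)).
  rewrite cosN cos_pihalf mul0r => <-.
  apply: eq_Rintegral => w _; rewrite cosBpihalf; congr sin; ring.
have icos x y : P.-integrable setT (EFin \o (fun w => cos (t * (x * U w + y * V w)))).
  have [mL _ _ _] := N x y.
  apply: (@bounded_integrable _ _ _ _ _ 1) => [|w]; last exact: cos_max.
  apply: measurableT_comp; first exact: measurable_cos.
  exact: measurable_funM.
have Ecos x y : \int[P]_w cos (t * (x * U w + y * V w)) =
    expR (- (t ^+ 2 * (x ^+ 2 * v + 2 * x * y * r + y ^+ 2 * v) / 2)).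
  have [_ _ _ cf] := N x y; have := cf t 0; rewrite cos0 mul1r => <-.
  by apply: eq_Rintegral => w _; rewrite addr0.
have Ess : \int[P]_w (sin (t * U w) * sin (t * V w)) =
    expR (-1) / 2 * (expR (r / v) - expR (- (r / v))).
  transitivity (2^-1 * (\int[P]_w cos (t * (1 * U w + (-1) * V w)) -
      \int[P]_w cos (t * (1 * U w + 1 * V w)))).
    rewrite -RintegralB// -RintegralZl//; last exact: integrableB_EFin.
    apply: eq_Rintegral => w _.
    have -> : t * (1 * U w + (-1) * V w) = t * U w - t * V w by ring.
    have -> : t * (1 * U w + 1 * V w) = t * U w + t * V w by ring.
    by rewrite cosB cosD; field.
  rewrite !Ecos t2.
  have v1 : v != 0 by rewrite gt_eqF.
  have -> : - (v^-1 * (1 ^+ 2 * v + 2 * 1 * -1 * r + (-1) ^+ 2 * v) / 2) = -1 + r / v.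
    by field.
  have -> : - (v^-1 * (1 ^+ 2 * v + 2 * 1 * 1 * r + 1 ^+ 2 * v) / 2) = -1 - r / v.
    by field.
  rewrite !expRD; ring.
have := covariance_mixing Fm Gm FG (msin _ mU) (fun w => sin_max _) (FU t)
  (msin _ mV) (fun w => sin_max _) (GV t).
rewrite Esin mul0r subr0 Ess normrM ger0_norm ?divr_ge0 ?expR_ge0// => h.
have h2 := abs_sinh_ge (r / v).
rewrite normrM normfV (gtr0_norm v0) in h2.
have e1 : expR (-1) * expR 1 = 1 :> R by rewrite -expRD addNr expR0.
have e0 : 0 < expR (-1) :> R by exact: expR_gt0.
have h3 : expR (-1) * (`|r| / v) <= 4 * a.
  apply: le_trans h.
  rewrite [X in X <= _](_ : _ = expR (-1) / 2 * (2 * (`|r| / v))); last by field; rewrite gt_eqF.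
  by rewrite ler_wpM2l// divr_ge0// ltW.
have h4 : `|r| / v <= 4 * expR 1 * a.
  rewrite -(ler_pM2l e0) (le_trans h3)//.
  rewrite [X in _ <= X](_ : _ = 4 * a * (expR (-1) * expR 1)); last ring.
  by rewrite e1 mulr1.
by rewrite -ler_pdivrMr.
Qed.
End gaussian_correlation.

(** * Linear marginals of a stationary mixing Gaussian process *)

Lemma integrableM_sqr d (Omega : measurableType d) (R : realType) (P : probability Omega R)
    (f g : Omega -> R) :
  measurable_fun setT f -> measurable_fun setT g ->
  P.-integrable setT (EFin \o (fun w => f w ^+ 2)) ->
  P.-integrable setT (EFin \o (fun w => g w ^+ 2)) ->
  P.-integrable setT (EFin \o (fun w => f w * g w)).
Proof.
move=> mf mg f2 g2.
apply: (le_integrable measurableT _ _ (integrableD_EFin f2 g2)).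
  by apply/measurable_EFinP; exact: measurable_funM.
move=> w _ /=; rewrite lee_fin normrM.
rewrite [leRHS]ger0_norm ?addr_ge0 ?sqr_ge0//.
rewrite -(real_normK (num_real (f w))) -(real_normK (num_real (g w))).
have := sqr_ge0 (`|f w| - `|g w|).
have := sqr_ge0 (`|f w| + `|g w|); lra.
Qed.

Section gaussian_stationary.
Context {R : realType} d (Omega : measurableType d) (P : probability Omega R).
Variables (I : finType) (Z : int -> I -> {RV P >-> R}).
Hypothesis statZ : strictly_stationary Z.
Hypothesis meanZ : mean_zero Z.
Hypothesis gaussZ : gaussian_process Z.

(** The definition of a Gaussian process speaks of combinations indexed by
    ordinals; here any finite index type is allowed, so that products of index
    types can be used directly. *)
Lemma gaussian_lincomb (J : finType) (t : J -> int) (i : J -> I) (a : J -> R) :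
  exists v, centered_normal P (fun w => \sum_j a j * Z (t j) (i j) w) v.
Proof.
have iZ s k : P.-integrable setT (EFin \o Z s k).
  have [m [sg law]] := gaussZ (fun _ : 'I_1 => s) (fun=> k) (fun=> 1).
  apply: (@gaussian_law_integrable _ _ _ _ _ m sg) => // A mA.
  rewrite -law//; congr (P _); apply/seteqP; split => w /=; by rewrite big_ord1 mul1r.
have EZ s k : \int[P]_w Z s k w = 0.
  by have := meanZ s k; rewrite unlock /Rintegral => ->.
pose e (k : 'I_#|J|) := enum_val k.
have [m [sg law]] := gaussZ (t \o e) (i \o e) (a \o e).
exists (sg ^+ 2).
have E w : \sum_(k < #|J|) a (e k) * Z (t (e k)) (i (e k)) w =
    \sum_j a j * Z (t j) (i j) w.
  rewrite [RHS](reindex e)//=; last exact/onW_bij/enum_val_bij.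
have [I1 I2] := Rintegral_finsum (fun j => @integrableZ_EFin _ _ _ P (a j) _ (iZ (t j) (i j))).
apply: (@gaussian_law_centered_normal _ _ _ _ _ m).
- by apply: measurable_sum => j; exact: measurable_funM.
- by move=> A mA; rewrite -law//; congr (P _); apply/seteqP; split => w /=; rewrite E.
- rewrite EFin_Rintegral// I2 big1// => j _.
  by rewrite RintegralZl// EZ mulr0.
Qed.

Variable u : I -> R.
Definition marginal (t : int) (w : Omega) : R := \sum_i u i * Z t i w.
Definition autocov (s t : int) : R := \int[P]_w (marginal s w * marginal t w).

Lemma measurable_marginal t : measurable_fun setT (marginal t).
Proof. by apply: measurable_sum => j; exact: measurable_funM. Qed.

Let mU := measurable_marginal.

Let lin (J : finType) (t : J -> int) (a : J -> R) :
  exists v, centered_normal P (fun w => \sum_j a j * marginal (t j) w) v.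
Proof.
have [v hv] := gaussian_lincomb (fun x : J * I => t x.1) (fun x => x.2) (fun x => a x.1 * u x.2).
exists v; move: hv; congr (centered_normal P _ _); apply/funext => w.
rewrite -(pair_bigA _ (fun j i => a j * u i * Z (t j) i w))/=.
apply: eq_bigr => j _; rewrite /marginal mulr_sumr.
by apply: eq_bigr => i _; rewrite mulrA.
Qed.

Lemma marginal_integrableM s t :
  P.-integrable setT (EFin \o (fun w => marginal s w * marginal t w)).
Proof.
have i2 r : P.-integrable setT (EFin \o (fun w => marginal r w ^+ 2)).
  have [v hv] := lin (fun _ : 'I_1 => r) (fun=> 1).
  apply: eq_integrable (centered_normal_integrable_sqr hv) => // w _ /=.
  by rewrite big_ord1 mul1r.
exact: integrableM_sqr.
Qed.

Lemma marginal_centered_normal (J : finType) (t : J -> int) (a : J -> R) :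
  centered_normal P (fun w => \sum_j a j * marginal (t j) w)
    (\sum_i \sum_j a i * a j * autocov (t i) (t j)).
Proof.
have [v hv] := lin t a.
suff -> : \sum_i \sum_j a i * a j * autocov (t i) (t j) = v by [].
rewrite -(centered_normal_variance hv).
have Ipair (x : J * J) : P.-integrable setT
   (EFin \o (fun w => a x.1 * a x.2 * (marginal (t x.1) w * marginal (t x.2) w))).
  by apply: integrableZ_EFin; exact: marginal_integrableM.
have [_ E] := Rintegral_finsum Ipair.
transitivity (\int[P]_w (\sum_x a x.1 * a x.2 * (marginal (t x.1) w * marginal (t x.2) w))).
  rewrite E pair_bigA/=; apply: eq_bigr => x _.
  by rewrite RintegralZl//; exact: marginal_integrableM.
apply: eq_Rintegral => w _.
rewrite expr2 mulr_suml -(pair_bigA _ (fun i j => a i * a j * (marginal (t i) w * marginal (t j) w)))/=.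
apply: eq_bigr => i _; rewrite mulr_sumr; apply: eq_bigr => j _; ring.
Qed.

Lemma autocovC s t : autocov s t = autocov t s.
Proof. by apply: eq_Rintegral => w _; rewrite mulrC. Qed.

(** The product moment of [marginal s] and [marginal t] is the integral of one
    fixed function on tuples against the joint law of the coordinates at the
    times [s] and [t], and stationarity is invariance of that law. *)
Lemma autocov_shift s t h : autocov (s + h) (t + h) = autocov s t.
Proof.
(* The pair [(b, i)] stands for coordinate [i] at time [s] or [t]. *)
pose n := #|{: bool * I}|.
pose e (k : 'I_n) : bool * I := enum_val k.
pose tt (k : 'I_n) := if (e k).1 then s else t.
pose V (h : int) (w : Omega) : n.-tuple R := [tuple Z (tt k + h) (e k).2 w | k < n].
have mV h' : measurable_fun setT (V h').
  apply/measurable_fun_tnthP => k.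
  rewrite (_ : _ \o _ = Z (tt k + h') (e k).2); first exact: measurable_funPT.
  by apply/funext => w /=; rewrite tnth_mktuple.
pose f (b : bool) (x : n.-tuple R) : R := \sum_(k < n) ((e k).1 == b)%:R * u (e k).2 * tnth x k.
have mf b : measurable_fun setT (f b).
  apply: measurable_sum => k; apply: measurable_funM => //.
  exact: measurable_tnth.
have fE b h' w : f b (V h' w) = marginal ((if b then s else t) + h') w.
  pose G (x : bool * I) := (x.1 == b)%:R * u x.2 * Z ((if x.1 then s else t) + h') x.2 w.
  transitivity (\sum_x G x).
    rewrite [RHS](reindex e)/=; last exact/onW_bij/enum_val_bij.
    by apply: eq_bigr => k _; rewrite /G /V tnth_mktuple.
  rewrite -(pair_bigA _ (fun b' i => G (b', i)))/= (bigD1 b)//= [X in _ + X]big1 ?addr0.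
    by apply: eq_bigr => i _; rewrite /G /= eqxx mul1r.
  by move=> b' /negbTE b'b; rewrite big1// => i _; rewrite /G /= b'b !mul0r.
pose F x := f true x * f false x.
have mF : measurable_fun setT (EFin \o F).
  by apply/measurable_EFinP; exact: measurable_funM.
have FE h' : (fun w => F (V h' w)) = (fun w => marginal (s + h') w * marginal (t + h') w).
  by apply/funext => w; rewrite /F !fE.
have IF h' : P.-integrable (V h' @^-1` setT) ((EFin \o F) \o V h').
  rewrite preimage_setT.
  have := marginal_integrableM (s + h') (t + h'); rewrite -FE; exact.
have cE h' : autocov (s + h') (t + h') =
    fine (\int[pushforward P (V h')]_x (F x)%:E)%E.
  rewrite /autocov -FE /Rintegral; congr fine.
  by rewrite (integral_pushforward (mV h') mF (IF h') measurableT) preimage_setT.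
rewrite cE -[s in RHS]addr0 -[t in RHS]addr0 cE; congr fine.
apply: eq_measure_integral => A mA _.
have := statZ tt (fun k => (e k).2) h mA.
rewrite [LHS]/= /pushforward => E.
have V0 : V 0 = (fun w => [tuple Z (tt k) (e k).2 w | k < n]).
  by apply/funext => w; apply: eq_mktuple => k; rewrite addr0.
by transitivity (P (V h @^-1` A)) => //; rewrite E -V0.
Qed.

Lemma sigma_process_measurable (D : set int) A : sigma_process Z D A -> measurable A.
Proof.
apply: smallest_sub; first exact: sigma_algebra_measurable.
move=> _ [t [i [B [_ mB ->]]]].
by rewrite -[X in measurable X]setTI; exact: measurable_funPT.
Qed.

Lemma sigma_process_sin (D : set int) t a c : D t ->
  sigma_process Z D [set w | c < sin (a * marginal t w)].
Proof.
move=> Dt.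
pose G := [set A | exists t i B, [/\ D t, measurable B & A = Z t i @^-1` B]].
have mZ i : measurable_fun [set: g_sigma_algebraType G] (Z t i : g_sigma_algebraType G -> R).
  move=> _ B mB; rewrite setTI; apply: sub_sigma_algebra.
  by exists t, i, B.
have mM : measurable_fun [set: g_sigma_algebraType G]
    ((fun w => sin (a * marginal t w)) : g_sigma_algebraType G -> R).
  apply: measurableT_comp; first exact: measurable_sin.
  apply: measurable_funM => //; apply: measurable_sum => i.
  exact: measurable_funM.
have := mM measurableT `]c, +oo[%classic (measurable_itv _).
rewrite setTI.
rewrite (_ : _ @^-1` _ = [set w | c < sin (a * marginal t w)])//.
by apply/seteqP; split => w /=; rewrite in_itv/= andbT.
Qed.

Lemma alpha_mix_ub l A B : sigma_process Z [set t | t <= 0] A ->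
  sigma_process Z [set t | l%:Z <= t] B ->
  `|fine (P (A `&` B)) - fine (P A) * fine (P B)| <= alpha_mix Z l.
Proof.
move=> FA GB; apply: ub_le_sup; last by exists A, B.
exists 1 => _ [A' [B' [/sigma_process_measurable mA /sigma_process_measurable mB ->]]].
have P01 C : measurable C -> 0 <= fine (P C) <= 1.
  by move=> mC; rewrite fine_ge0//= -lee_fin fineK ?fin_num_measure// probability_le1.
have /andP[a0 a1] := P01 _ mA; have /andP[b0 b1] := P01 _ mB.
have /andP[c0 c1] := P01 _ (measurableI _ _ mA mB).
have ab0 : 0 <= fine (P A') * fine (P B') by exact: mulr_ge0.
have ab1 : fine (P A') * fine (P B') <= 1 by rewrite mulr_ile1.
by rewrite ler_norml; apply/andP; split; lra.
Qed.

Let v := autocov 0 0.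

Lemma autocov_diag t : autocov t t = v.
Proof. by rewrite -[t]add0r autocov_shift. Qed.

Lemma autocov_mixing (l : nat) : 0 < v ->
  `|autocov 0 l| <= 4 * expR 1 * alpha_mix Z l * v.
Proof.
move=> v0.
apply: (@gaussian_correlation_mixing _ _ _ P _ _ (marginal 0) (marginal l) v (autocov 0 l) (alpha_mix Z l)
  (@sigma_process_measurable _) (@sigma_process_measurable _) (@alpha_mix_ub l) v0).
- move=> x y.
  have := marginal_centered_normal (fun b : bool => if b then 0 else l%:Z) (fun b => if b then x else y).
  congr (centered_normal P _ _).
    by apply/funext => w; rewrite big_bool.
  rewrite !big_bool/= !autocov_diag (autocovC l 0); ring.
- by move=> a c; apply: sigma_process_sin => /=.
- by move=> a c; apply: sigma_process_sin => /=.
Qed.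

Lemma alpha_mix_ge0 l : 0 < v -> 0 <= alpha_mix Z l.
Proof.
move=> v0; have h := le_trans (normr_ge0 _) (autocov_mixing l v0).
have e0 : 0 < 4 * expR 1 * v :> R by rewrite !mulr_gt0 ?expR_gt0.
by rewrite -(pmulr_rge0 _ e0) mulrAC.
Qed.

(** At lag 0, [autocov_mixing] compares a nondegenerate variable with itself and
    so bounds [alpha_mix Z 0] from below. *)
Lemma S_alpha_lower T : 0 < v -> 1 <= 4 * expR 1 * S_alpha Z T.
Proof.
move=> v0; have := autocov_mixing 0 v0; rewrite autocov_diag gtr0_norm// => h.
have h1 : 1 <= 4 * expR 1 * alpha_mix Z 0.
  by rewrite -(ler_pM2r v0) mul1r.
apply: (le_trans h1); rewrite ler_wpM2l ?mulr_ge0 ?expR_ge0//.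
rewrite /S_alpha big_ltn// lerDl sumr_ge0// => l _; exact: alpha_mix_ge0.
Qed.

(** With truncated subtraction [i - j + (j - i)] is the distance of [i] and
    [j]. *)
Lemma autocov_dist (i j : nat) : 0 < v ->
  `|autocov i.+1 j.+1| <= 4 * expR 1 * v * alpha_mix Z (i - j + (j - i)).
Proof.
move=> v0; wlog ij : i j / (i <= j)%N.
  move=> h; have [ij|ji] := leqP i j; first exact: h.
  by rewrite autocovC addnC; apply: h; exact: ltnW.
have -> : autocov i.+1 j.+1 = autocov 0 (j - i)%N.
  rewrite -(autocov_shift 0 (j - i)%N i.+1); congr autocov; lia.
rewrite (_ : (i - j)%N = 0%N) ?add0n; last by apply/eqP; rewrite subn_eq0.
by rewrite (le_trans (autocov_mixing _ v0))// mulrAC.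
Qed.

(** From a given [i], each distance is attained at most twice. *)
Lemma sum_dist_le (f : nat -> R) (T i : nat) : (forall l, 0 <= f l) -> (i < T)%N ->
  \sum_(j < T) f (i - j + (j - i))%N <= 2 * \sum_(0 <= l < T.+1) f l.
Proof.
move=> f0 iT.
have sub m n : (m <= n)%N -> \sum_(0 <= l < m) f l <= \sum_(0 <= l < n) f l.
  move=> mn; rewrite (big_cat_nat (leq0n m) mn)/= lerDl.
  by apply: sumr_ge0.
rewrite -(big_mkord xpredT (fun j => f (i - j + (j - i))%N)).
rewrite (big_cat_nat (leq0n i.+1) iT)/=.
have -> : \sum_(0 <= j < i.+1) f (i - j + (j - i))%N = \sum_(0 <= l < i.+1) f l.
  rewrite big_nat_rev/=; apply: eq_big_nat => j /andP[_ ji].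
  by congr f; lia.
have -> : \sum_(i.+1 <= j < T) f (i - j + (j - i))%N = \sum_(0 <= l < T - i.+1) f l.+1.
  rewrite -{1}[i.+1]add0n big_addn; apply: eq_big_nat => j _.
  by congr f; lia.
have h1 : \sum_(0 <= l < i.+1) f l <= \sum_(0 <= l < T.+1) f l by apply: sub; lia.
have h2 : \sum_(0 <= l < T - i.+1) f l.+1 <= \sum_(0 <= l < T.+1) f l.
  apply: (@le_trans _ _ (\sum_(0 <= l < (T - i.+1).+1) f l)); last by apply: sub; lia.
  by rewrite [leRHS]big_nat_recl//= lerDr.
lra.
Qed.

Let K T := 8 * expR 1 * S_alpha Z T * v.

Let Q T : 'M[R]_T := \matrix_(i < T, j < T) autocov i.+1 j.+1.

Let symQ T : (Q T)^T = Q T.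
Proof. by apply/matrixP => i j; rewrite !mxE autocovC. Qed.

Let normalU T (a : 'I_T -> R) :
  centered_normal P (fun w => \sum_i a i * marginal (i : nat).+1 w)
    (\sum_i \sum_j a i * a j * Q T i j).
Proof.
have := marginal_centered_normal (fun i : 'I_T => (i : nat).+1 : int) a.
congr (centered_normal P _ _).
by apply: eq_bigr => i _; apply: eq_bigr => j _; rewrite mxE.
Qed.

Let rowQ T i : 0 < v -> \sum_j `|Q T i j| <= K T.
Proof.
move=> v0.
apply: (@le_trans _ _ (\sum_(j < T) 4 * expR 1 * v * alpha_mix Z (i - j + (j - i)))).
  by apply: ler_sum => j _; rewrite mxE autocov_dist.
rewrite -mulr_sumr.
have := @sum_dist_le (alpha_mix Z) T i (fun l => alpha_mix_ge0 l v0) (ltn_ord i).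
have e0 : 0 <= 4 * expR 1 * v :> R by rewrite !mulr_ge0 ?expR_ge0// ltW.
move/(ler_wpM2l e0) => h; apply: (le_trans h); rewrite /K /S_alpha.
by rewrite le_eqVlt; apply/orP; left; apply/eqP; ring.
Qed.

Let trQ T : \tr (Q T) = T%:R * v.
Proof.
rewrite /mxtrace (eq_bigr (fun=> v)) ?sumr_const ?card_ord ?mulr_natl//.
by move=> i _; rewrite mxE autocov_diag.
Qed.

Lemma marginal_scale_gt0 T : 0 < v -> 0 < 8 * expR 1 * S_alpha Z T * v.
Proof.
move=> v0; rewrite mulr_gt0//; have := S_alpha_lower T v0; lra.
Qed.

Lemma marginal_lower_tail T dl : 0 < v -> 0 < dl ->
  (P [set w | \sum_(t < T) marginal (t : nat).+1 w ^+ 2 <= T%:R * v - T%:R * dl]%R <=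
   (expR (- (T%:R * dl ^+ 2 / (16 * (8 * expR 1 * S_alpha Z T * v) ^+ 2))))%:E)%E.
Proof.
move=> v0 dl0; rewrite -trQ.
have K0 := marginal_scale_gt0 T v0.
exact: (quadratic_lower_tail (symQ T) (@normalU T) (ltW K0) (fun i => rowQ i v0)).
Qed.

(** The range [dl <= 2 * K] of [quadratic_upper_tail] contains
    [dl <= 2 * autocov 0 0] because [S_alpha_lower] makes [K] at least twice that
    variance. *)
Lemma marginal_upper_tail T dl : 0 < v -> 0 < dl -> dl <= 2 * v ->
  (P [set w | T%:R * v + T%:R * dl <= \sum_(t < T) marginal (t : nat).+1 w ^+ 2]%R <=
   (expR (- (T%:R * dl ^+ 2 / (16 * (8 * expR 1 * S_alpha Z T * v) ^+ 2))))%:E)%E.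
Proof.
move=> v0 dl0 dlv; rewrite -trQ.
have K0 := marginal_scale_gt0 T v0.
apply: (quadratic_upper_tail (symQ T) (@normalU T) (ltW K0) (fun i => rowQ i v0)) => //.
apply: (le_trans dlv); rewrite ler_wpM2l// ler_peMl ?(ltW v0)//.
have := S_alpha_lower T v0; lra.
Qed.

End gaussian_stationary.

(** * From finitely many vectors to all vectors *)

Section maurey.
Context {R : realType} (p : nat).
Implicit Types (M : 'M[R]_p) (x y v b : 'cV[R]_p).

Definition bform M x y : R := (x^T *m M *m y) 0 0.

Lemma bformDr M x y z : bform M x (y + z) = bform M x y + bform M x z.
Proof. by rewrite /bform mulmxDr mxE. Qed.

Lemma bformDl M x y z : bform M (x + y) z = bform M x z + bform M y z.
Proof. by rewrite /bform linearD/= !mulmxDl mxE. Qed.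

Lemma bformZr M a x y : bform M x (a *: y) = a * bform M x y.
Proof. by rewrite /bform -scalemxAr mxE. Qed.

Lemma bformZl M a x y : bform M (a *: x) y = a * bform M x y.
Proof. by rewrite /bform linearZ/= -!scalemxAl mxE. Qed.

Lemma bform_sumr M x (I : finType) (f : I -> 'cV[R]_p) :
  bform M x (\sum_i f i) = \sum_i bform M x (f i).
Proof. by rewrite /bform mulmx_sumr summxE. Qed.

Lemma bformC M x y : M^T = M -> bform M x y = bform M y x.
Proof.
move=> symM; have -> : bform M x y = ((x^T *m M *m y)^T) 0 0 by rewrite [RHS]mxE.
by rewrite !trmx_mul trmxK symM mulmxA.
Qed.

Lemma bform_sqr M x y : M^T = M ->
  bform M (x + y) (x + y) = bform M x x + 2 * bform M x y + bform M y y.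
Proof. by move=> symM; rewrite bformDl !bformDr (bformC y x symM); ring. Qed.

Lemma bform_delta M i : bform M (delta_mx i 0) (delta_mx i 0) = M i i.
Proof. by rewrite /bform trmx_delta -rowE -colE !mxE. Qed.

Lemma bformDM M1 M2 x y : bform (M1 + M2) x y = bform M1 x y + bform M2 x y.
Proof. by rewrite /bform mulmxDr mulmxDl mxE. Qed.

Lemma bformNM M x y : bform (- M) x y = - bform M x y.
Proof. by rewrite /bform mulmxN mulNmx mxE. Qed.

Lemma bform_scalar a x : bform a%:M x x = a * \sum_i x i 0 ^+ 2.
Proof.
rewrite /bform mul_mx_scalar -scalemxAl mxE; congr (_ * _).
by rewrite mxE; apply: eq_bigr => i _; rewrite mxE expr2.
Qed.

Definition signed_basis (i : 'I_p * bool) : 'cV[R]_p := (-1) ^+ i.2 *: delta_mx i.1 0.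

(** Repetitions are allowed and opposite letters cancel, so distinct sequences
    may give the same vector. *)
Definition word (s : seq ('I_p * bool)) : 'cV[R]_p := \sum_(i <- s) signed_basis i.

(** Maurey's empirical method, without a probability space. The right-hand side is
    the mean of the form at [b] plus a sum of [m] independent random signed basis
    vectors with mean v / |v|_1; the induction adds them one at a time. The mean
    over a single letter is the convex combination with weights |v_i| / |v|_1, and
    the letter [(i, v i 0 < 0)] has the sign of v_i. *)
Lemma maurey_average M m b v : M^T = M -> 0 < l1norm v ->
  (forall s, size s = m -> 0 <= bform M (b + word s) (b + word s)) ->
  0 <= bform M (b + m%:R *: ((l1norm v)^-1 *: v)) (b + m%:R *: ((l1norm v)^-1 *: v)) +
    m%:R * ((l1norm v)^-1 * \sum_i `|v i 0| * M i i -
            bform M ((l1norm v)^-1 *: v) ((l1norm v)^-1 *: v)).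
Proof.
move=> symM N0; set N := l1norm v; set vb := N^-1 *: v; set D := N^-1 * _.
have N1 : N != 0 by rewrite gt_eqF.
elim: m b => [|m IH] b H.
  by have := H [::] erefl; rewrite /word big_nil scale0r mul0r !addr0.
pose e i := signed_basis (i, v i 0 < 0).
pose c := b + m%:R *: vb.
have step i : 0 <= bform M (c + e i) (c + e i) + m%:R * (D - bform M vb vb).
  have := IH (b + e i); rewrite addrAC; apply => s sz.
  have := H ((i, v i 0 < 0) :: s); rewrite /= sz => /(_ erefl).
  by rewrite /word big_cons addrA.
have ev : \sum_i (`|v i 0| / N) *: e i = vb.
  apply/colP => j; rewrite summxE !mxE (bigD1 j)//= big1 ?addr0.
    rewrite !mxE !eqxx/= mulr1 mulrAC mulrC; congr (_ * _).
    by rewrite mulrC -numEsign.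
  by move=> i ij; rewrite !mxE eq_sym (negbTE ij)/= !mulr0.
have sumw : \sum_i `|v i 0| / N = 1 by rewrite -mulr_suml mulfV.
have qe i : bform M (e i) (e i) = M i i.
  by rewrite bformZl bformZr bform_delta mulrA -expr2 sqrr_sign mul1r.
have E i : bform M (c + e i) (c + e i) =
    bform M c c + 2 * bform M c (e i) + M i i.
  by rewrite bform_sqr// qe.
have : 0 <= \sum_i `|v i 0| / N * (bform M (c + e i) (c + e i) + m%:R * (D - bform M vb vb)).
  by apply: sumr_ge0 => i _; rewrite mulr_ge0// divr_ge0// ltW.
have -> : \sum_i `|v i 0| / N * (bform M (c + e i) (c + e i) + m%:R * (D - bform M vb vb)) =
   bform M c c + 2 * bform M c vb + D + m%:R * (D - bform M vb vb).
  transitivity (\sum_i (`|v i 0| / N * (bform M c c + m%:R * (D - bform M vb vb)) +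
      2 * (bform M c ((`|v i 0| / N) *: e i)) + N^-1 * (`|v i 0| * M i i))).
    apply: eq_bigr => i _; rewrite E (bformZr M (`|v i 0| / N) c (e i)).
    move: (D - _) (bform M c c) (bform M c (e i)) (N^-1) => x1 x2 x3 x4; ring.
  rewrite !big_split/= -mulr_suml sumw -mulr_sumr -bform_sumr ev -mulr_sumr -/D.
  ring.
have -> : b + m.+1%:R *: vb = c + vb by rewrite /c -natr1 scalerDl scale1r addrA.
rewrite bform_sqr// -natr1 => h.
by apply: le_trans h _; rewrite le_eqVlt; apply/orP; left; apply/eqP; ring.
Qed.

(** [maurey_average] with [b = 0] and [m.+1] letters, multiplied by
    |v|_1^2 / (m + 1). *)
Lemma maurey_bound M m v (mu : R) : M^T = M ->
  (forall s, size s = m.+1 -> 0 <= bform M (word s) (word s)) ->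
  (forall i, M i i <= mu) ->
  0 <= m%:R * bform M v v + mu * l1norm v ^+ 2.
Proof.
move=> symM H Mmu.
have [N0|] := ltP 0 (l1norm v); last first.
  have l0 : 0 <= l1norm v by exact: sumr_ge0.
  move=> l0'; have N0 : l1norm v = 0 by apply/eqP; rewrite eq_le l0' l0.
  have v0 : v = 0.
    apply/colP => i; rewrite mxE; apply/eqP; rewrite -normr_eq0; apply/eqP.
    have /psumr_eq0P h := N0; exact: h.
  by rewrite N0 v0 /bform mulmx0 mxE mulr0 expr0n mulr0 addr0.
have N1 : l1norm v != 0 by rewrite gt_eqF.
have H0 s : size s = m.+1 -> 0 <= bform M (0 + word s) (0 + word s).
  by move=> sz; rewrite add0r; exact: H.
have := maurey_average symM N0 H0; rewrite add0r !bformZl !bformZr.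
set N := l1norm v; set q := bform M v v; set D := \sum_i _ => h.
have DN : D <= mu * N.
  rewrite /D mulr_sumr; apply: ler_sum => i _.
  by rewrite mulrC ler_wpM2r.
have m0 : 0 < m.+1%:R :> R by rewrite ltr0n.
have : 0 <= m.+1%:R / N ^+ 2 * (m%:R * q + N * D).
  apply: le_trans h _; rewrite le_eqVlt; apply/orP; left; apply/eqP.
  by rewrite -natr1; field.
rewrite pmulr_rge0; last by rewrite divr_gt0// exprn_gt0.
move=> h2; apply: le_trans h2 _; rewrite lerD2l expr2 mulrA (mulrC mu) -mulrA.
by rewrite ler_wpM2l// ltW.
Qed.

(** [maurey_bound] for the form [G - S + lam / 4]: nonnegativity on words and the
    bound [lam / 2] on its diagonal are the two hypotheses on [G], and [S] is at
    least [lam]. *)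
Lemma restricted_eigenvalue_extension (G S : 'M[R]_p) (lam : R) (s : nat) v :
  G^T = G -> S^T = S -> (0 < s)%N -> 0 <= lam ->
  (forall x, lam * \sum_i x i 0 ^+ 2 <= bform S x x) ->
  (forall w, size w = s.+1 -> bform S (word w) (word w) - lam / 4 * \sum_i word w i 0 ^+ 2
     <= bform G (word w) (word w)) ->
  (forall i, G i i <= S i i + lam / 4) ->
  lam / 2 * \sum_i v i 0 ^+ 2 - lam / 2 / s%:R * l1norm v ^+ 2 <= bform G v v.
Proof.
move=> symG symS s0 lam0 Slam Gw Gii.
pose M := G - S + (lam / 4)%:M.
have symM : M^T = M by rewrite /M !linearD linearN/= symG symS tr_scalar_mx.
have ME x : bform M x x = bform G x x - bform S x x + lam / 4 * \sum_i x i 0 ^+ 2.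
  by rewrite /M !bformDM bformNM bform_scalar.
have := @maurey_bound M s v (lam / 2) symM.
have H1 w : size w = s.+1 -> 0 <= bform M (word w) (word w).
  by move=> sz; rewrite ME; have := Gw w sz; lra.
have H2 i : M i i <= lam / 2.
  by rewrite /M !mxE eqxx mulr1n; have := Gii i; lra.
move=> /(_ H1 H2); rewrite ME => h.
have sR : 0 < s%:R :> R by rewrite ltr0n.
have Sl := Slam v.
set l2 := \sum_i _ in h Sl *; set l1 := l1norm v in h *.
have h2 : 0 <= bform G v v - bform S v v + lam / 4 * l2 + lam / 2 / s%:R * l1 ^+ 2.
  rewrite -(pmulr_rge0 _ sR).
  apply: le_trans h _; rewrite le_eqVlt; apply/orP; left; apply/eqP; field.
  by rewrite gt_eqF.
have l20 : 0 <= l2 by apply: sumr_ge0 => i _; exact: sqr_ge0.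
have ll : 0 <= lam * l2 by exact: mulr_ge0.
lra.
Qed.
End maurey.

(** * Sample covariance of the regressors *)

Section regressors.
Context {R : realType} d (Omega : measurableType d) (P : probability Omega R).
Context (p q : nat) (X : int -> 'I_p -> {RV P >-> R}) (Y : int -> 'I_q -> {RV P >-> R}).

Definition regressor_weights (u : 'cV[R]_p) (x : 'I_p + 'I_q) : R :=
  if x is inl j then u j 0 else 0.

Lemma marginal_regressor u t w :
  marginal (joint_process X Y) (regressor_weights u) t w = \sum_i u i 0 * X t i w.
Proof.
rewrite /marginal big_sumType/= [X in _ + X]big1 ?addr0// => j _.
by rewrite mul0r.
Qed.

Lemma Gamma_hat_form T w u :
  bform (Gamma_hat X T w) u u =
  T%:R^-1 * \sum_(t < T) marginal (joint_process X Y) (regressor_weights u) (t : nat).+1 w ^+ 2.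
Proof.
rewrite /bform /Gamma_hat -scalemxAr -scalemxAl mxE; congr (_ * _).
rewrite mulmxA -trmx_mul -mulmxA mxE; apply: eq_bigr => t _.
rewrite mxE expr2 marginal_regressor !mxE.
by congr (_ * _); apply: eq_bigr => i _; rewrite mxE mulrC.
Qed.

Lemma tr_Gamma_hat T w : (Gamma_hat X T w)^T = Gamma_hat X T w.
Proof. by rewrite /Gamma_hat linearZ/= trmx_mul trmxK. Qed.

Lemma measurable_Gamma_hat_form T u :
  measurable_fun setT (fun w => bform (Gamma_hat X T w) u u).
Proof.
rewrite (_ : (fun w => _) = (fun w => T%:R^-1 * \sum_(t < T)
    marginal (joint_process X Y) (regressor_weights u) (t : nat).+1 w ^+ 2)); last first.
  by apply/funext => w; exact: Gamma_hat_form.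
apply: measurable_funM => //; apply: measurable_sum => t.
by apply: measurable_funX; exact: measurable_marginal.
Qed.

(** Square integrability of the coordinates, which lets the expectation pass
    through the double sum, is that of the marginals for basis vectors. *)
Lemma autocov_regressor u : mean_zero (joint_process X Y) -> gaussian_process (joint_process X Y) ->
  autocov (joint_process X Y) (regressor_weights u) 0 0 = bform (Sigma_mx X) u u.
Proof.
move=> meanZ gaussZ.
have i2 i : P.-integrable setT (EFin \o (fun w => X 0 i w ^+ 2)).
  have := marginal_integrableM meanZ gaussZ (regressor_weights (delta_mx i 0)) 0 0.
  apply: eq_integrable => // w _ /=; rewrite marginal_regressor (bigD1 i)//= big1.
    by rewrite !mxE !eqxx mul1r addr0 expr2.
  by move=> j ji; rewrite !mxE (negbTE ji) mul0r.
have iM i j : P.-integrable setT (EFin \o (fun w => X 0 i w * X 0 j w)).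
  exact: integrableM_sqr.
have iA (x : 'I_p * 'I_p) : P.-integrable setT
    (EFin \o (fun w => u x.1 0 * u x.2 0 * (X 0 x.1 w * X 0 x.2 w))).
  exact: integrableZ_EFin.
have [_ E] := Rintegral_finsum iA.
transitivity (\int[P]_w (\sum_x u x.1 0 * u x.2 0 * (X 0 x.1 w * X 0 x.2 w))).
  apply: eq_Rintegral => w _; rewrite !marginal_regressor mulr_suml.
  rewrite -(pair_bigA _ (fun i j => u i 0 * u j 0 * (X 0 i w * X 0 j w)))/=.
  apply: eq_bigr => i _; rewrite mulr_sumr; apply: eq_bigr => j _; ring.
rewrite E -(pair_bigA _ (fun i j => \int[P]_w (u i 0 * u j 0 * (X 0 i w * X 0 j w))))/=.
rewrite exchange_big/= /bform mxE; apply: eq_bigr => j _.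
rewrite mxE mulr_suml; apply: eq_bigr => i _.
by rewrite RintegralZl// !mxE unlock /Rintegral/= -mulrA [X in _ * X]mulrC mulrA.
Qed.

End regressors.

Lemma rat_vector_approx (R : realType) p (v : 'cV[R]_p) :
  exists r : nat -> 'cV[rat]_p, forall i, ratr (r n i 0) @[n --> \oo] --> v i 0.
Proof.
have /choice[r hr] : forall x : nat * 'I_p,
    exists q : rat, v x.2 0 < ratr q < v x.2 0 + x.1.+1%:R^-1.
  move=> x; have [|q] := @rat_in_itvoo R (v x.2 0) (v x.2 0 + x.1.+1%:R^-1).
    by rewrite ltrDl invr_gt0 ltr0n.
  by rewrite in_itv/= => hq; exists q.
exists (fun n => \col_i r (n, i)) => i.
apply: (@squeeze_cvgr _ _ _ _ (fun=> v i 0) (fun n => v i 0 + n.+1%:R^-1)).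
- by apply: nearW => n; rewrite mxE; have /andP[/ltW -> /ltW ->] := hr (n, i).
- exact: cvg_cst.
- rewrite -[X in _ --> X]addr0; apply: cvgD; first exact: cvg_cst.
  exact: cvg_harmonic.
Qed.

Lemma cvg_sumr (R : realType) (I : finType) (F : I -> nat -> R) (l : I -> R) :
  (forall i, F i n @[n --> \oo] --> l i) ->
  \sum_i F i n @[n --> \oo] --> \sum_i l i.
Proof.
move=> Fl; apply: cvg_big => //.
exact: add_continuous.
Qed.

Section restricted_eigenvalue_event.
Context {R : realType} d (Omega : measurableType d).
Variables (p : nat) (G : Omega -> 'M[R]_p) (a b : R).

Let D v w := `|bform (G w) v v| - (a * l2norm v ^+ 2 - b * l1norm v ^+ 2).

Lemma cvg_bform M (r : nat -> 'cV[R]_p) (v : 'cV[R]_p) :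
  (forall i, r n i 0 @[n --> \oo] --> v i 0) ->
  bform M (r n) (r n) @[n --> \oo] --> bform M v v.
Proof.
move=> rv; rewrite /bform mxE.
under eq_cvg do rewrite mxE.
apply: cvg_sumr => i; apply: cvgM => //.
rewrite mxE; under eq_cvg do rewrite mxE.
apply: cvg_sumr => j; apply: cvgM; last exact: cvg_cst.
by rewrite mxE (_ : (fun n => _) = (fun n => r n j 0))//; apply/funext => n; rewrite mxE.
Qed.

(** For fixed [w] both sides are continuous in [v], so it suffices to test the
    countably many rational vectors. *)
Lemma measurable_restricted_eigenvalue :
  (forall v, measurable_fun setT (fun w => bform (G w) v v)) ->
  measurable [set w | forall v : 'cV[R]_p,
    a * l2norm v ^+ 2 - b * l1norm v ^+ 2 <= `|bform (G w) v v|].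
Proof.
move=> mG.
pose rv n : 'cV[R]_p := if @unpickle 'cV[rat]_p n is Some r then map_mx ratr r else 0.
rewrite (_ : mkset _ = \bigcap_n [set w | 0 <= D (rv n) w]); last first.
  apply/seteqP; split => [w H n _ /=|w H v]; first by rewrite subr_ge0.
  have [r rcv] := rat_vector_approx v.
  have rv' i : (map_mx ratr (r n) : 'cV[R]_p) i 0 @[n --> \oo] --> v i 0.
    rewrite (_ : (fun n => _) = (fun n => ratr (r n i 0)))//.
    by apply/funext => n; rewrite mxE.
  rewrite -subr_ge0 -/(D v w).
  have DE x : D x w = `|bform (G w) x x| - (a * (\sum_i x i 0 ^+ 2) - b * (\sum_i `|x i 0|) ^+ 2).
    by rewrite /D /l2norm sqr_sqrtr// sumr_ge0// => i _; rewrite sqr_ge0.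
  have cD : D (map_mx ratr (r n)) w @[n --> \oo] --> D v w.
    rewrite DE; under eq_cvg do rewrite DE.
    apply: cvgB; first by apply: cvg_norm; exact: cvg_bform.
    apply: cvgB; apply: cvgMr.
      by apply: cvg_sumr => i; apply: cvgM.
    have h : \sum_i `|(map_mx ratr (r n) : 'cV[R]_p) i 0| @[n --> \oo] --> \sum_i `|v i 0|.
      by apply: cvg_sumr => i; apply: cvg_norm.
    exact: cvgM.
  apply: (@cvgr_to_ge _ _ _ _ _ _ _ cD); apply: nearW => n.
  have := H (pickle (r n)) I; rewrite /= /rv pickleK; exact.
apply: bigcapT_measurable => n.
apply: measurable_set_ge.
apply: measurable_funB => //; apply: measurableT_comp => //.
Qed.
End restricted_eigenvalue_event.

Lemma union_bound (R : realType) d (Omega : measurableType d) (P : probability Omega R)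
    (I : finType) (B : I -> set Omega) (E : set Omega) (eps : R) :
  (forall i, measurable (B i)) -> measurable E -> (forall i, (P (B i) <= eps%:E)%E) ->
  (forall w, (forall i, ~ B i w) -> E w) ->
  ((1 - #|I|%:R * eps)%:E <= P E)%E.
Proof.
move=> mB mE PB BE.
pose U := \big[setU/set0]_i B i.
have mU : measurable U by exact: bigsetU_measurable.
have PU : (P U <= (#|I|%:R * eps)%:E)%E.
  apply: (@le_trans _ _ (\sum_i P (B i))%E).
    rewrite /U; elim: (index_enum I) => [|i s IH]; first by rewrite !big_nil measure0.
    rewrite !big_cons; apply: (le_trans (measureU2 _ _ _)) => //.
      exact: bigsetU_measurable.
    exact: leeD2l.
  apply: (@le_trans _ _ (\sum_(i : I) eps%:E)%E); first exact: lee_sum.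
  by rewrite sumEFin sumr_const cardE -cardT mulr_natl.
apply: (@le_trans _ _ (P (~` U))).
  by rewrite probability_setC// EFinB leeB.
apply: le_measure; rewrite ?inE//; first exact: measurableC.
move=> w nU; apply: BE => i Bi; apply: nU.
by rewrite /U (bigD1 i)//=; left.
Qed.

(** From exp (-1/2) >= 1 - 1/2, squared. *)
Lemma expR1_le4 (R : realType) : expR 1 <= 4 :> R.
Proof.
have h : (1 / 2 : R) <= expR (- (1 / 2)).
  by apply: le_trans (expR_ge1Dx _); lra.
have e2 : expR 1 * expR (- (1 / 2)) ^+ 2 = 1 :> R.
  rewrite expr2 -!expRD (_ : _ + _ = 0) ?expR0//; lra.
have h2 : (1 / 4 : R) <= expR (- (1 / 2)) ^+ 2.
  by rewrite (_ : 1 / 4 = (1 / 2) ^+ 2); [rewrite ler_sqr// nnegrE; lra|field].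
have := expR_gt0 (1 : R); nra.
Qed.

(** With e <= 4 and pi >= 2, the ratio of (lam / 4) n2 to 8 e S v is at least
    27/16 eta, and (27/16)^2 / 16 > 1/6. *)
Lemma tail_exponent (R : realType) (S lam lmax n2 v eta : R) :
  0 < S -> 0 < lam -> 0 < lmax -> 0 < n2 -> 0 < v -> v <= lmax * n2 ->
  eta = lam / (108 * pi * S * lmax) ->
  eta ^+ 2 / 6 <= (lam / 4 * n2) ^+ 2 / (16 * (8 * expR 1 * S * v) ^+ 2).
Proof.
move=> S0 lam0 lmax0 n0 v0 vle etaE.
have e4 := expR1_le4 R; have e0 := expR_gt0 (1 : R); have pi2 := pi_ge2 R.
have K0 : 0 < 8 * expR 1 * S * v by rewrite !mulr_gt0.
set r := lam / 4 * n2 / (8 * expR 1 * S * v).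
have -> : (lam / 4 * n2) ^+ 2 / (16 * (8 * expR 1 * S * v) ^+ 2) = r ^+ 2 / 16.
  by rewrite /r; field; rewrite !gt_eqF.
have pi0 : 0 < pi :> R by lra.
have eta0 : 0 < eta by rewrite etaE divr_gt0// !mulr_gt0.
have lamE : lam = eta * (108 * pi * S * lmax).
  by rewrite etaE divfK// gt_eqF// !mulr_gt0.
have hr : 27 / 16 * eta <= r.
  rewrite /r ler_pdivlMr//.
  have h1 : 8 * expR 1 * S * v <= 32 * S * (lmax * n2).
    apply: ler_pM => //; first by rewrite !mulr_ge0// ltW.
      by rewrite ltW.
    by rewrite ler_wpM2r ?(ltW S0)//; lra.
  have h2 : 0 <= eta * S * lmax * n2 by rewrite !mulr_ge0// ltW.
  have h3 : 27 / 16 * eta * (8 * expR 1 * S * v) <= 27 / 16 * eta * (32 * S * (lmax * n2)).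
    by rewrite ler_wpM2l// mulr_ge0// ltW.
  apply: (le_trans h3); rewrite lamE.
  have h4 : 0 <= (eta * S * lmax * n2) * (pi - 2) by rewrite mulr_ge0//; lra.
  nra.
have : (27 / 16 * eta) ^+ 2 <= r ^+ 2.
  by rewrite ler_sqr// nnegrE; lra.
have := sqr_ge0 eta; nra.
Qed.

(** Since 2p <= p^2, both [p] and the number of words are at most
    exp (2 (s + 1) ln p). By the bound on [s] the exponent is at most
    T M / 20 + 4 ln p, and the hypothesis on [T] makes ln p at most T M / 420;
    the sum is well below T M (1/6 - 1/20). *)
Lemma union_count_le (R : realType) (p s T : nat) (M : R) :
  (2 <= p)%N -> 0 < M ->
  42 * expR 1 * ln p%:R / (1 / 10 * M) <= T%:R ->
  s%:R <= 1 / 10 * (T%:R / (4 * ln p%:R)) * M + 1 ->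
  ((p * 2) ^ s.+1 + p)%:R * expR (- (T%:R * (M / 6))) <=
    2 * expR (- (1 / 10 / 2 * T%:R * M)).
Proof.
move=> p2 M0; set L := ln p%:R => hT hs.
have p0 : 0 < p%:R :> R by rewrite ltr0n ltnW.
have L0 : 0 < L by rewrite ln_gt0// ltr1n.
have pE : p%:R = expR L by rewrite lnK.
have e1 : 1 <= expR 1 :> R by apply: le_trans (expR_ge1Dx _); lra.
have TM : 420 * L <= T%:R * M.
  move: hT; rewrite ler_pdivrMr ?mulr_gt0//.
  have : 0 <= L * (expR 1 - 1) by rewrite mulr_ge0 ?subr_ge0// ltW.
  lra.
have sL : s%:R * (4 * L) <= T%:R * M / 10 + 4 * L.
  have := hs; rewrite -(ler_pM2r (_ : 0 < 4 * L)); last by rewrite mulr_gt0.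
  move/le_trans; apply; rewrite le_eqVlt; apply/orP; left; apply/eqP; field.
  by rewrite gt_eqF.
pose N := s.+1%:R * (2 * L).
have c1 : ((p * 2) ^ s.+1)%:R <= expR N.
  rewrite /N expRM_natl natrX lerXn2r ?nnegrE ?expR_ge0//.
  rewrite -[2 * L]/(2%:R * L) expRM_natl -pE natrM expr2 (ler_wpM2l (ltW p0))//.
  by rewrite ler_nat.
have c2 : p%:R <= expR N.
  rewrite pE ler_expR /N -natr1; have : 0 <= s%:R * L by rewrite mulr_ge0// ltW.
  lra.
have c3 : expR N * expR (- (T%:R * (M / 6))) <= expR (- (1 / 10 / 2 * T%:R * M)).
  rewrite -expRD ler_expR /N -natr1.
  have : 0 <= T%:R * M by rewrite mulr_ge0// ltW.
  lra.
rewrite natrD; have := expR_gt0 (- (T%:R * (M / 6))); nra.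
Qed.

Section regressor_tails.
Context {R : realType} d (Omega : measurableType d) (P : probability Omega R).
Context (p q : nat) (X : int -> 'I_p -> {RV P >-> R}) (Y : int -> 'I_q -> {RV P >-> R}).
Let Z := joint_process X Y.
Let Sigma := Sigma_mx X.
Let lam := lambda_min Sigma.
Let eta T := lam / (108 * pi * S_alpha Z T * lambda_max Sigma).
Hypothesis p0 : (0 < p)%N.
Hypothesis statZ : strictly_stationary Z.
Hypothesis meanZ : mean_zero Z.
Hypothesis gaussZ : gaussian_process Z.
Hypothesis pdS : posdefmx Sigma.

Lemma sqnorm_gt0 (u : 'cV[R]_p) : u != 0 -> 0 < \sum_i u i 0 ^+ 2.
Proof.
move=> u0; rewrite lt_neqAle sumr_ge0 ?andbT => [|i _]; last exact: sqr_ge0.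
apply: contra u0 => /eqP/esym/psumr_eq0P h; apply/eqP/colP => i.
by apply/eqP; rewrite mxE -sqrf_eq0 h// => j _; exact: sqr_ge0.
Qed.

Lemma Sigma_rayleigh (u : 'cV[R]_p) : lam * \sum_i u i 0 ^+ 2 <= bform Sigma u u
  <= lambda_max Sigma * \sum_i u i 0 ^+ 2.
Proof. by have [_ h] := posdef_rayleigh p0 pdS; exact: h. Qed.

Lemma lambda_min_gt0 : 0 < lam.
Proof. by have [] := posdef_rayleigh p0 pdS. Qed.

Let u0 : 'cV[R]_p := delta_mx (Ordinal p0) 0.
Let u0_neq0 : u0 != 0.
Proof.
apply/eqP => /colP/(_ (Ordinal p0)); rewrite !mxE !eqxx/=.
by move/eqP; rewrite oner_eq0.
Qed.

Lemma lambda_max_gt0 : 0 < lambda_max Sigma.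
Proof.
have n0 := sqnorm_gt0 u0_neq0.
have /andP[h1 h2] := Sigma_rayleigh u0.
rewrite -(pmulr_lgt0 _ n0); apply: lt_le_trans h2; apply: lt_le_trans h1.
by rewrite mulr_gt0// lambda_min_gt0.
Qed.

Lemma regressor_variance_gt0 u : u != 0 -> 0 < bform Sigma u u.
Proof. by case: pdS => _; exact. Qed.

(** By [S_alpha_lower] for one nonzero marginal; this makes [eta] a genuine
    quotient. *)
Lemma S_alpha_gt0 T : 0 < S_alpha Z T.
Proof.
have := @S_alpha_lower _ _ _ _ _ Z statZ meanZ gaussZ (regressor_weights u0) T.
rewrite autocov_regressor// => /(_ (regressor_variance_gt0 u0_neq0)) h.
by rewrite -(pmulr_rgt0 _ (_ : 0 < 4 * expR 1)) ?(lt_le_trans ltr01 h)//.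
Qed.

Lemma eta_gt0 T : 0 < eta T.
Proof.
have pi2 := pi_ge2 R.
rewrite divr_gt0 ?lambda_min_gt0// !mulr_gt0 ?S_alpha_gt0 ?lambda_max_gt0//.
lra.
Qed.

(** The deviation [dl = lam / 4 * |u|^2] scales like the variance u'Su, which is
    at most lambda_max |u|^2, so that the exponent has a bound free of [u]. *)
Lemma Gamma_hat_tails T (u : 'cV[R]_p) : (0 < T)%N -> u != 0 ->
  (P [set w | bform (Gamma_hat X T w) u u <=
      bform Sigma u u - lam / 4 * \sum_i u i 0 ^+ 2]%R <=
     (expR (- (T%:R * (eta T ^+ 2 / 6))))%:E)%E /\
  (P [set w | bform Sigma u u + lam / 4 * \sum_i u i 0 ^+ 2 <=
      bform (Gamma_hat X T w) u u]%R <=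
     (expR (- (T%:R * (eta T ^+ 2 / 6))))%:E)%E.
Proof.
move=> T0 un0; set n2 := \sum_i _.
have TR : 0 < T%:R :> R by rewrite ltr0n.
have n20 : 0 < n2 := sqnorm_gt0 un0.
have v0 := regressor_variance_gt0 un0; set v := bform Sigma u u in v0 *.
have vE : autocov Z (regressor_weights u) 0 0 = v by exact: autocov_regressor.
have lam0 := lambda_min_gt0.
have /andP[vlow vup] := Sigma_rayleigh u.
have dl0 : 0 < lam / 4 * n2 by rewrite mulr_gt0// divr_gt0.
have v0' : 0 < autocov Z (regressor_weights u) 0 0 by rewrite vE.
have expo : expR (- (T%:R * (lam / 4 * n2) ^+ 2 /
    (16 * (8 * expR 1 * S_alpha Z T * v) ^+ 2))) <= expR (- (T%:R * (eta T ^+ 2 / 6))).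
  rewrite ler_expR lerN2 -mulrA (ler_wpM2l (ltW TR))//.
  exact: (tail_exponent (S_alpha_gt0 T) lam0 lambda_max_gt0 n20 v0 vup erefl).
have lowE (x y : R) : (T%:R^-1 * x <= y) = (x <= T%:R * y).
  by rewrite ler_pdivrMl.
have upE (x y : R) : (x <= T%:R^-1 * y) = (T%:R * x <= y).
  by rewrite ler_pdivlMl.
split.
  have := marginal_lower_tail statZ meanZ gaussZ T v0' dl0.
  rewrite vE -mulrBr => h; apply: (le_trans _ (le_trans h _)); last by rewrite lee_fin.
  rewrite le_eqVlt; apply/orP; left; apply/eqP; congr (P _).
  by apply/seteqP; split => w /=; rewrite (Gamma_hat_form X Y) lowE.
have dlv : lam / 4 * n2 <= 2 * autocov Z (regressor_weights u) 0 0.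
  by rewrite vE; move: vlow; rewrite -/v -/n2; lra.
have := marginal_upper_tail statZ meanZ gaussZ T v0' dl0 dlv.
rewrite vE -mulrDr => h; apply: (le_trans _ (le_trans h _)); last by rewrite lee_fin.
rewrite le_eqVlt; apply/orP; left; apply/eqP; congr (P _).
by apply/seteqP; split => w /=; rewrite (Gamma_hat_form X Y) upE.
Qed.

End regressor_tails.

Lemma tr_Sigma_mx (R : realType) d (Omega : measurableType d) (P : probability Omega R)
  p (X : int -> 'I_p -> {RV P >-> R}) : (Sigma_mx X)^T = Sigma_mx X.
Proof.
apply/matrixP => i j; rewrite !mxE unlock; congr fine; apply: eq_integral => w _ /=.
by rewrite mulrC.
Qed.

Theorem proposition3 (R : realType) :
  exists c : R, 0 < c /\
  forall (d : measure_display) (Omega : measurableType d)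
    (P : probability Omega R) (p q : nat)
    (X : int -> 'I_p -> {RV P >-> R}) (Y : int -> 'I_q -> {RV P >-> R})
    (T : nat),
  let Z := joint_process X Y in
  let Sigma := Sigma_mx X in
  let eta := lambda_min Sigma /
    (108 * pi * S_alpha Z T * lambda_max Sigma) in
  let alpha_RE := lambda_min Sigma / 2 in
  let tau := alpha_RE /
    (Num.ceil (c * (T%:R / (4 * ln p%:R)) * Num.min 1 (eta ^+ 2)))%:~R in
  (2 <= p)%N ->
  strictly_stationary Z ->
  mean_zero Z ->
  alpha_mixing Z ->
  gaussian_process Z ->
  posdefmx Sigma ->
  42 * expR 1 * ln p%:R / (c * Num.min 1 (eta ^+ 2)) <= T%:R ->
  ((1 - 2 * expR (- (c / 2 * T%:R * Num.min 1 (eta ^+ 2))))%:E <=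
   P [set w | forall v : 'cV[R]_p,
        (alpha_RE * l2norm v ^+ 2 - tau * l1norm v ^+ 2 <=
          `|(v^T *m Gamma_hat X T w *m v) 0 0|)%R])%E.
Proof.
(* The value of [c] is one for which [union_count_le] holds. *)
exists (1 / 10); split; first by rewrite divr_gt0.
move=> d Omega P p q X Y T Z Sigma eta alpha_RE tau p2 statZ meanZ _ gaussZ pdS hT.
have p0 : (0 < p)%N by exact: ltnW.
have lam0 : 0 < lambda_min Sigma := lambda_min_gt0 p0 pdS.
have eta0 : 0 < eta := eta_gt0 p0 statZ meanZ gaussZ pdS T.
set M := Num.min 1 (eta ^+ 2) in tau hT *.
have M0 : 0 < M by rewrite lt_min ltr01 exprn_gt0.
have L0 : 0 < ln p%:R :> R by rewrite ln_gt0// ltr1n.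
have T0 : (0 < T)%N.
  rewrite -(ltr0n R); apply: lt_le_trans hT.
  by rewrite divr_gt0 ?mulr_gt0 ?expR_gt0.
have TR : 0 < T%:R :> R by rewrite ltr0n.
set x := 1 / 10 * (T%:R / (4 * ln p%:R)) * M in tau *.
have x0 : 0 < x by rewrite !mulr_gt0// invr_gt0 mulr_gt0.
have c0 : (0 < Num.ceil x) by rewrite ceil_gt0.
pose s := `|Num.ceil x|%N.
have sE : (Num.ceil x)%:~R = s%:R :> R by rewrite /s natr_absz gtr0_norm.
have s0 : (0 < s)%N by rewrite absz_gt0 gt_eqF.
have sx : s%:R <= x + 1.
  by rewrite -sE; have /andP[/ltW] := ceil_itv x; rewrite intrB lerBlDr.
pose n2 (u : 'cV[R]_p) := \sum_i u i 0 ^+ 2.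
(* The bad events: a lower deviation at some word, or an upper deviation at some
   basis vector. A word may vanish, by cancellation; the tail bounds do not apply
   to the zero vector, but there is nothing to exclude there. *)
pose wd (z : seq ('I_p * bool)) : 'cV[R]_p := word z.
pose B (k : (s.+1).-tuple ('I_p * bool) + 'I_p) : set Omega := match k with
  | inl z => if wd z == 0 then set0 else
     [set w | bform (Gamma_hat X T w) (wd z) (wd z) <=
      bform Sigma (wd z) (wd z) - lambda_min Sigma / 4 * n2 (wd z)]
  | inr i => [set w | bform Sigma (delta_mx i 0) (delta_mx i 0) +
       lambda_min Sigma / 4 * n2 (delta_mx i 0) <=
       bform (Gamma_hat X T w) (delta_mx i 0) (delta_mx i 0)]
  end.
have dneq0 i : delta_mx i 0 != 0 :> 'cV[R]_p.
  apply/eqP => /colP/(_ i); rewrite !mxE !eqxx/=.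
  by move/eqP; rewrite oner_eq0.
have mform u : measurable_fun setT (fun w => bform (Gamma_hat X T w) u u).
  exact: (measurable_Gamma_hat_form X Y).
have mB k : measurable (B k).
  case: k => [z|i] /=; last exact: measurable_set_ge.
  by case: ifP => _ //; exact: measurable_set_le.
have expM : expR (- (T%:R * (eta ^+ 2 / 6))) <= expR (- (T%:R * (M / 6))).
  rewrite ler_expR lerN2 ler_pM2l// ler_pM2r ?invr_gt0//.
  by rewrite ge_min lexx orbT.
have PB k : (P (B k) <= (expR (- (T%:R * (M / 6))))%:E)%E.
  have tails u : u != 0 -> _ := Gamma_hat_tails p0 statZ meanZ gaussZ pdS T0.
  case: k => [z|i] /=.
    case: ifPn => [_|z0]; first by rewrite measure0 lee_fin expR_ge0.
    by have [h _] := tails _ z0; apply: le_trans h _; rewrite lee_fin.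
  by have [_ h] := tails _ (dneq0 i); apply: le_trans h _; rewrite lee_fin.
apply: le_trans (union_bound mB (measurable_restricted_eigenvalue _ _ mform) PB _).
  rewrite lee_fin lerB//.
  rewrite card_sum card_tuple card_prod card_bool !card_ord.
  exact: union_count_le.
move=> w nB v /=.
apply: (le_trans _ (ler_norm _)).
rewrite /l2norm sqr_sqrtr; last by apply: sumr_ge0 => i _; exact: sqr_ge0.
rewrite /tau /alpha_RE sE.
apply: (restricted_eigenvalue_extension (S := Sigma)) => //.
- exact: tr_Gamma_hat.
- exact: tr_Sigma_mx.
- exact: ltW.
- by move=> y; have /andP[] := Sigma_rayleigh p0 pdS y.
- move=> z sz; have := nB (inl (Tuple (introT eqP sz))) => /=.
  rewrite -/(wd z); case: ifPn => [/eqP -> _|_ /negP].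
    rewrite /bform !mulmx0 [X in X - _]mxE [leRHS]mxE sub0r oppr_le0.
    by rewrite mulr_ge0 ?sumr_ge0// ?divr_ge0 ?(ltW lam0)// => i _; exact: sqr_ge0.
  by rewrite -ltNge => /ltW.
- move=> i; have /negP := nB (inr i); rewrite -ltNge !bform_delta => /ltW.
  rewrite /n2 (bigD1 i)//= big1 ?addr0 => [|j ji]; last by rewrite !mxE (negbTE ji) expr0n.
  by rewrite !mxE !eqxx expr1n mulr1.
Qed.
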